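(* Let $s \in \mathbb{N}$, let $b$ be a prime, let $m \in \mathbb{N}$, $N = b^m$, and let $0 = w_1 \leq w_2 \leq \cdots$ be a sequence of non-negative integers. Let $\alpha > 1$ be real and let $(\gamma_j)_{j \ge 1}$ be positive weights with $\gamma_{\mathfrak{u}} = \prod_{j \in \mathfrak{u}} \gamma_j$. Let $\tilde{\boldsymbol{z}} = (\tilde{z}_1, \dots, \tilde{z}_s)$ be constructed by the combined component-by-component algorithm described in the context, with exclusion sets $\mathcal{E}_1, \dots, \mathcal{E}_s$. Then for all $1 \leq d \leq s$ and all $\frac{1}{\alpha} < \lambda \leq 1$ we have $$e^2(\tilde{z}_1, \dots, \tilde{z}_d) \leq \left( \sum_{\mathfrak{u} \subseteq \{1,\dots,d\}} \frac{\gamma_{\mathfrak{u}}^{\lambda} (4 \zeta(\alpha \lambda))^{|\mathfrak{u}|}}{\phi\left(b^{\max\{0,\, m - \max_{j \in \mathfrak{u}} w_j\}}\right)} \prod_{j \in \mathfrak{u}} \frac{|\mathcal{Z}_{N,w_j}|}{|\mathcal{Z}_{N,w_j}| - |\mathcal{E}_j|} \right)^{\frac{1}{\lambda}},$$ where $\phi$ denotes the Euler totient function, and where we set $\max \emptyset = 0$.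
   Context: Notation: $\mathbb{N} = \{1,2,\dots\}$; $\zeta$ is the Riemann zeta function; $|\cdot|$ of a finite set is its cardinality; a product over the empty set is $1$, in particular $\gamma_\emptyset = 1$. Search spaces: $\mathcal{Z}_N = \{ z \in \{1, \dots, N-1\} : \gcd(z,N) = 1\}$. For $j \in \mathbb{N}$, $\mathcal{Z}_{N,w_j} = \{ z \in \{1, \dots, b^{m-w_j}-1\} : \gcd(z,b^m) = 1\}$ if $w_j < m$, and $\mathcal{Z}_{N,w_j} = \{1\}$ if $w_j \geq m$. (So $\mathcal{Z}_{N,w_j} = \mathcal{Z}_N$ when $w_j = 0$.) Weighted Korobov space and worst-case error: For $\boldsymbol{h} = (h_1, \dots, h_d) \in \mathbb{Z}^d$ set $r_\alpha(\boldsymbol{\gamma}, \boldsymbol{h}) = \prod_{j=1}^d r_\alpha(\gamma_j, h_j)$, where $r_\alpha(\gamma_j, 0) = 1$ and $r_\alpha(\gamma_j, h_j) = \gamma_j / |h_j|^\alpha$ for $h_j \neq 0$. The weighted Korobov space $H(K_{d,\alpha,\boldsymbol{\gamma}})$ is the reproducing kernel Hilbert space of functions on $[0,1]^d$ with kernel $K_{d,\alpha,\boldsymbol{\gamma}}(\boldsymbol{x}, \boldsymbol{y}) = \sum_{\boldsymbol{h} \in \mathbb{Z}^d} r_\alpha(\boldsymbol{\gamma}, \boldsymbol{h}) \exp(2\pi \mathrm{i}\, \boldsymbol{h} \cdot (\boldsymbol{x} - \boldsymbol{y}))$. For $\boldsymbol{z} = (z_1,\dots,z_d) \in \{0, \dots,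 N-1\}^d$, $e(\boldsymbol{z}) = e(z_1,\dots,z_d)$ denotes the worst-case error of integration in $H(K_{d,\alpha,\boldsymbol{\gamma}})$, i.e. the supremum over $f$ in its unit ball of $\left| \int_{[0,1]^d} f(\boldsymbol{x})\, d\boldsymbol{x} - \frac{1}{N} \sum_{k=0}^{N-1} f(\{k\boldsymbol{z}/N\}) \right|$, where $\{\cdot\}$ is the componentwise fractional part. It is known that its square is $$e^2(\boldsymbol{z}) = \sum_{\substack{\boldsymbol{h} \in \mathbb{Z}^d \setminus \{\boldsymbol{0}\} \\ \boldsymbol{z} \cdot \boldsymbol{h} \equiv 0 \pmod N}} r_\alpha(\boldsymbol{\gamma}, \boldsymbol{h}).$$ Combined component-by-component algorithm (produces $\tilde{\boldsymbol{z}} = (\tilde z_1, \dots, \tilde z_s)$): 1. Set $z_1 = 1$, $\tilde z_1 = z_1 = 1$ and $\mathcal{E}_1 = \emptyset$. 2. Successively for $d = 1, \dots, s-1$, assuming $\tilde z_1, \dots, \tilde z_d$ have been found: - If $w_{d+1} < m$: choose an arbitrary proper subset $\mathcal{E}_{d+1} \subsetneq \mathcal{Z}_{N,w_{d+1}}$ (possibly empty; it may depend on the components already chosen). Choose $z_{d+1} \in \mathcal{Z}_{N,w_{d+1}} \setminus \mathcal{E}_{d+1}$ such that $e^2(\tilde z_1, \dots, \tilde z_d, b^{w_{d+1}} z_{d+1})$ is minimized as a function of $z_{d+1}$ over $\mathcal{Z}_{N,w_{d+1}} \setminus \mathcal{E}_{d+1}$, and set $\tilde z_{d+1} = b^{w_{d+1}}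 z_{d+1}$. - If $w_{d+1} \geq m$: set $\mathcal{E}_{d+1} = \emptyset$ and $\tilde z_{d+1} = z_{d+1} = 0$. *)

(* Defs.v *)
From HB Require Import structures.
From mathcomp Require Import all_boot all_order all_algebra.
From mathcomp Require Import complex.
From mathcomp Require Import all_classical all_reals all_analysis.

Set Implicit Arguments.
Unset Strict Implicit.
Unset Printing Implicit Defensive.
Import Order.TTheory GRing.Theory Num.Theory.
Import numFieldNormedType.Exports.

Local Open Scope classical_set_scope.
Local Open Scope ring_scope.
Local Open Scope complex_scope.

(* Coordinates, weights and components are indexed from 0: position [j] of a
   tuple or of a sequence [w], [gamma], [z], [E] holds the component that is
   usually numbered [j + 1]. *)

(* Unordered sum of a real, resp. complex, family: the sum of the positive parts
   minus that of the negative parts; meaningful for absolutely summable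
   families. *)
Definition rsum (R : realType) (I : choiceType) (f : I -> R) : R :=
  fine (\esum_(i in [set: I]) (Num.max (f i) 0)%:E)
  - fine (\esum_(i in [set: I]) (Num.max (- f i) 0)%:E).

Definition csum (R : realType) (I : choiceType) (f : I -> R[i]) : R[i] :=
  rsum (fun i => complex.Re (f i)) +i* rsum (fun i => complex.Im (f i)).

Definition zeta (R : realType) (x : R) : R :=
  limn (series (fun n : nat => n.+1%:R `^ (- x))).

(* A reproducing kernel Hilbert space on [X] with kernel [K]: a complete complex
   inner product space (the inner product being linear in its first argument)
   whose vectors are identified with functions on [X] by the injective map
   [rkhs_fun]; [rkhs_ker y] is the vector standing for [K(., y)]. Completeness
   is stated with the squared norm. Such a space is unique up to isometry. *)
Record rkhs (R : realType) (X : Type) (K : X -> X -> R[i]) := Rkhs {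
  rkhs_car : lmodType R[i];
  rkhs_dot : {dot rkhs_car for Num.conj};
  rkhs_fun : rkhs_car -> X -> R[i];
  rkhs_fun_scalar : forall x : X, scalar (rkhs_fun ^~ x);
  rkhs_fun_inj : injective rkhs_fun;
  rkhs_complete : forall u : nat -> rkhs_car,
    (forall e : R, 0 < e -> exists n0 : nat, forall p q : nat,
       (n0 <= p)%N -> (n0 <= q)%N ->
       complex.Re (rkhs_dot (u p - u q) (u p - u q)) < e) ->
    exists v : rkhs_car, forall e : R, 0 < e ->
      exists n0 : nat, forall p : nat, (n0 <= p)%N ->
        complex.Re (rkhs_dot (u p - v) (u p - v)) < e;
  rkhs_ker : X -> rkhs_car;
  rkhs_kerE : forall x y : X, rkhs_fun (rkhs_ker y) x = K x y;
  rkhs_repr : forall (f : rkhs_car) (y : X),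
    rkhs_fun f y = rkhs_dot f (rkhs_ker y) }.

Definition cube (R : realType) (d : nat) : set (d.-tuple R) :=
  [set x | forall j, 0 <= tnth x j <= 1].
Arguments cube R d : clear implicits.

Section cube_measure.
Variable R : realType.

Definition tcons (d : nat) (p : measurableTypeR R * d.-tuple R) : d.+1.-tuple R :=
  [tuple of p.1 :: p.2].

Lemma measurable_tcons d : measurable_fun setT (@tcons d).
Proof. exact: measurable_cons. Qed.

HB.instance Definition _ d :=
  isMeasurableFun.Build _ _ _ _ (@tcons d) (@measurable_tcons d).

(* Lebesgue measure on [0,1]^d, extended by 0 outside the cube: the d-fold
   product of the uniform probability on [0,1]. *)
Fixpoint cube_measure (d : nat) : probability (d.-tuple R) R :=
  match d with
  | 0 => \d_ ([tuple] : 0.-tuple R)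
  | d'.+1 => distribution
     (uniform_prob (@ltr01 R) \x cube_measure d')%E (@tcons d')
  end.

End cube_measure.
Arguments cube_measure R d : clear implicits.

Definition cube_integral (R : realType) (d : nat) (f : cube R d -> R[i]) :
    R[i] :=
  Rintegral (cube_measure R d) (cube R d)
    (fun x => complex.Re (valL_ 0 f x))
  +i* Rintegral (cube_measure R d) (cube R d)
    (fun x => complex.Im (valL_ 0 f x)).

Definition korobov_r1 (R : realType) (alpha gamma : R) (h : int) : R :=
  if h == 0 then 1 else gamma / (`|h|%:~R `^ alpha).

Definition korobov_r (R : realType) (alpha : R) (gamma : nat -> R) (d : nat)
    (h : d.-tuple int) : R :=
  \prod_(j < d) korobov_r1 alpha (gamma j) (tnth h j).

Definition expi (R : realType) (t : R) : R[i] := cos t +i* sin t.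

Definition korobov_kernel (R : realType) (alpha : R) (gamma : nat -> R)
    (d : nat) (x y : cube R d) : R[i] :=
  csum (fun h : d.-tuple int =>
    (korobov_r alpha gamma h)%:C *
    expi (2 * pi * \sum_(j < d)
            (tnth h j)%:~R * (tnth (set_val x) j - tnth (set_val y) j))).

Definition frac (R : realType) (x : R) : R := x - (Num.floor x)%:~R.

Lemma lattice_point_subproof (R : realType) (N d : nat) (z : d.-tuple nat)
    (k : nat) :
  [tuple frac ((k * tnth z j)%:R / N%:R : R) | j < d] \in cube R d.
Proof.
apply/mem_set => j; rewrite tnth_mktuple /frac subr_ge0 floor_le /=.
by rewrite lerBlDl ltW // -[X in _ + X]/(1%:~R) -intrD floorD1_gt.
Qed.

Definition lattice_point (R : realType) (N d : nat) (z : d.-tuple nat)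
    (k : nat) : cube R d :=
  SigSub (@lattice_point_subproof R N d z k).

(* The supremum is taken in the extended reals, so no boundedness is assumed. *)
Definition wce (R : realType) (d : nat) (K : cube R d -> cube R d -> R[i])
    (H : rkhs K) (N : nat) (z : d.-tuple nat) : \bar R :=
  ereal_sup [set (Normc.normc (cube_integral (rkhs_fun f)
      - (N%:R)^-1 * \sum_(k < N) rkhs_fun f (lattice_point R N z k)))%:E
    | f in [set f : rkhs_car H | rkhs_dot H f f <= 1]].

(* The bound [z < b ^ m] carried by the ordinal type is implied by membership, as
   soon as [1 < b ^ m]. *)
Definition search_space (b m w : nat) : {set 'I_(b ^ m)} :=
  if (w < m)%N
  then [set z : 'I_(b ^ m) | (0 < z < b ^ (m - w))%N && coprime z (b ^ m)]%SET
  else [set z : 'I_(b ^ m) | z == 1%N :> nat]%SET.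

Definition extend (zt : nat -> nat) (d c : nat) : d.+1.-tuple nat :=
  [tuple of rcons [tuple zt i | i < d] c].

(* [combined_cbc e2 w s E z zt] holds when [zt 0, ..., zt (s - 1)] is a
   possible output of the combined component-by-component algorithm minimizing
   the squared error [e2], with exclusion sets [E] and choices [z]; in the
   minimization step the first [d] components are already fixed. *)
Definition combined_cbc (R : realType)
    (e2 : forall d : nat, d.-tuple nat -> \bar R) (b m : nat) (w : nat -> nat)
    (s : nat) (E : nat -> {set 'I_(b ^ m)}) (z : nat -> 'I_(b ^ m))
    (zt : nat -> nat) : Prop :=
  [/\ z 0%N = 1%N :> nat, zt 0%N = 1%N, E 0%N = finset.set0 &
   forall d : nat, (0 < d < s)%N ->
     if (w d < m)%N then
       [/\ E d \proper search_space b m (w d),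
           z d \in search_space b m (w d) :\: E d,
           forall c, c \in search_space b m (w d) :\: E d ->
             (e2 d.+1 (extend zt d (b ^ w d * z d)%N)
              <= e2 d.+1 (extend zt d (b ^ w d * c)%N))%E
         & zt d = (b ^ w d * z d)%N]
     else [/\ E d = finset.set0, z d = 0%N :> nat & zt d = 0%N]].

(* Main.v *)
(* The integration functional on a space with the Korobov kernel is bounded, so by
   Riesz it is represented by a vector; evaluating it on the kernel shows that
   this vector is the constant function 1. The squared worst-case error is thus
   the squared distance from 1 to the mean of the kernel functions at the
   lattice points, and orthogonality of characters turns it into [S - 1], where
   [S] sums [r(h)] over the lattice_dot lattice.

   Adding a component [c] increases [S] by a sum [theta(c)] over the lattice_dot vectors
   whose last entry is nonzero. By Jensen's inequality
   [theta(c) ^ lambda <= theta'(c)], with [alpha] and [gamma] replaced by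
   [alpha * lambda] and [gamma ^ lambda], and the minimal [theta] is at most the
   mean over the admissible [c]. Averaging [theta'] over the whole search space
   gains the factor [phi(b ^ (m - w))]: a congruence [a + b ^ w c k = 0 mod b ^ m]
   has at most [g] solutions [c] for a [g] depending only on [a], and none unless
   [g] divides [k]. *)

Require Import Defs.
From mathcomp Require Import ring lra.
From HB Require Import structures.
From mathcomp Require Import all_boot all_order all_algebra.
From mathcomp Require Import complex.
From mathcomp Require Import all_classical all_reals all_analysis.
From mathcomp Require Import measurable_realfun.

Set Implicit Arguments.
Unset Strict Implicit.
Unset Printing Implicit Defensive.
Import Order.TTheory GRing.Theory Num.Theory.
Import numFieldNormedType.Exports.
Local Open Scope ring_scope.
Local Open Scope classical_set_scope.

(** * Unordered sums of nonnegative families *)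

(** The induction bounds [e2 ^ lambda], not [e2]: the power is subadditive for [lambda <= 1], so the
    recursion [S(z, c) = S(z) + theta(c)] survives it, and the exponent [1 / lambda] is applied once
    at the end. The recursion closes because [w] is nondecreasing: among the subsets of the first
    [d + 1] indices, those containing the last one all have the maximum [w d]. The sum over one
    nonzero entry gives [2 * zeta], one [zeta] for each sign; the [4] of the statement is reached by
    enlarging this constant. The analytic obstacle is that a vector of an abstract reproducing
    kernel space comes as a bare function on the cube, while linearity of its integral requires
    measurability. Continuity of the kernel at the diagonal and Cauchy-Schwarz make each such
    function a pointwise limit of step functions on ever finer grids. Signed series are not
    exchanged with integrals directly: each cosine is shifted by 1, so that only nonnegative terms
    occur. *)

Lemma esumZl (R : realType) (T : choiceType) (c : R) (f : T -> \bar R)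
    (I : set T) : 0 <= c -> (forall i, (0 <= f i)%E) ->
  (\esum_(i in I) (c%:E * f i) = c%:E * \esum_(i in I) f i)%E.
Proof.
have le_esumZl (c' : R) (g : T -> \bar R) : 0 <= c' -> (forall i, (0 <= g i)%E) ->
    (\esum_(i in I) (c'%:E * g i) <= c'%:E * \esum_(i in I) g i)%E.
  move=> c0 g0; apply: ge_ereal_sup => _ [X [finX XI] <-].
  rewrite -ge0_mule_fsumr//; apply: lee_wpmul2l; first by rewrite lee_fin.
  by apply: ereal_sup_ubound; exists X.
(* The reverse inequality is the same one for [c^-1] and the family [c * f]. *)
move=> c0 f0; apply/eqP; rewrite eq_le le_esumZl//=.
have [<-|cN0] := eqVneq 0 c; last have {}c0 : 0 < c by rewrite lt_neqAle cN0.
  by rewrite mul0e; apply: esum_ge0 => i _; rewrite mul0e.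
have cV : (c^-1%:E * c%:E = 1 :> \bar R)%E by rewrite -EFinM mulVf// gt_eqF.
have h0 i : (0 <= c%:E * f i)%E by rewrite mule_ge0// lee_fin ltW.
have /= := le_esumZl c^-1 _ _ h0; rewrite invr_ge0 (ltW c0) => /(_ isT).
under eq_esum do rewrite muleA cV mul1e.
have c0E : (0 <= c%:E)%E by rewrite lee_fin ltW.
move=> /(lee_wpmul2l c0E) /le_trans; apply.
by rewrite muleA -EFinM divff ?gt_eqF// mul1e.
Qed.

Lemma lee_esum_subset (R : realType) (T : choiceType) (f : T -> \bar R)
    (I J : set T) : (forall i, (0 <= f i)%E) -> I `<=` J ->
  (\esum_(i in I) f i <= \esum_(i in J) f i)%E.
Proof.
move=> f0 IJ; apply: ge_ereal_sup => _ [X [finX XI] <-].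
by apply: ereal_sup_ubound; exists X => //; split=> //; exact: subset_trans IJ.
Qed.

(* Each term is at most the total [S], hence [f i <= S `^ (1 - l) * f i `^ l]. *)
Lemma powR_esum_le (R : realType) (T : choiceType) (l : R) (f : T -> R) :
  0 < l <= 1 -> (forall i, 0 <= f i) ->
  (\esum_(i in [set: T]) (f i)%:E < +oo)%E ->
  (((fine (\esum_(i in [set: T]) (f i)%:E)) `^ l)%:E
    <= \esum_(i in [set: T]) (f i `^ l)%:E)%E.
Proof.
move=> /andP[l0 l1] f0 foo.
have sf : \esum_(i in [set: T]) (f i)%:E \is a fin_num.
  rewrite fin_numElt foo andbT (lt_le_trans (ltNyr 0))//.
  by apply: esum_ge0 => i _; rewrite lee_fin.
set S := fine _; have SE : \esum_(i in [set: T]) (f i)%:E = S%:E by rewrite fineK.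
have fS i : f i <= S.
  rewrite -lee_fin -SE -[leLHS](@esum_set1 _ _ i (fun i => (f i)%:E)) ?lee_fin//.
  by apply: lee_esum_subset => // j; rewrite lee_fin.
have S0 : 0 <= S.
  by rewrite -lee_fin -SE; apply: esum_ge0 => i _; rewrite lee_fin.
have [->|SN0] := eqVneq S 0.
  by rewrite powR0 ?gt_eqF//; apply: esum_ge0 => i _; rewrite lee_fin powR_ge0.
have Sgt0 : 0 < S by rewrite lt_neqAle eq_sym SN0.
have SlE : S `^ (1 - l) * S `^ l = S by rewrite -powRD ?subrK ?powRr1 ?SN0 ?implybT.
rewrite -(@lee_pmul2l _ (S `^ (1 - l))%:E) ?lte_fin ?powR_gt0//.
rewrite -esumZl ?powR_ge0//; last by move=> i; rewrite lee_fin powR_ge0.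
rewrite -EFinM SlE -SE; apply: le_esum => i _; rewrite -EFinM lee_fin.
have [->|fN0] := eqVneq (f i) 0; first by rewrite mulr_ge0 ?powR_ge0.
rewrite -[leLHS]powRr1// -{1}(subrK l 1) powRD ?fN0 ?implybT//.
by rewrite ler_wpM2r ?powR_ge0// ge0_ler_powR ?nnegrE// subr_ge0.
Qed.

(** This is [powR_esum_le] for a family indexed by [bool]. *)
Lemma powR_add_le (R : realType) (l x y : R) :
  0 < l <= 1 -> 0 <= x -> 0 <= y -> (x + y) `^ l <= x `^ l + y `^ l.
Proof.
move=> l01 x0 y0.
have bE (g : bool -> \bar R) : (forall b, 0 <= g b)%E ->
    \esum_(b in [set: bool]) g b = (g true + g false)%E.
  move=> g0; rewrite (esumID [set true])//.
  rewrite [X in esum X](_ : _ = [set true]) ?setTI// esum_set1//.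
  rewrite [X in esum X](_ : _ = [set false]) ?esum_set1//.
  by apply/seteqP; split=> -[]//= [].
have := @powR_esum_le R bool l (fun b => if b then x else y) l01.
rewrite !bE//=; last 2 first.
- by case; rewrite lee_fin ?powR_ge0.
- by case; rewrite lee_fin.
by apply; [case|rewrite -EFinD ltry].
Qed.

Lemma esum_int (R : realType) (f : int -> \bar R) : (forall k, (0 <= f k)%E) ->
  (\esum_(k in [set: int]) f k = f 0%R +
   (\esum_(n in [set: nat]) f n.+1%:Z + \esum_(n in [set: nat]) f (- n.+1%:Z)%R))%E.
Proof.
move=> f0; rewrite (esumID [set 0%Z])// setTI esum_set1//; congr (_ + _)%E.
rewrite (esumID [set k : int | 0 < k])//; congr (_ + _)%E.
  apply: (@reindex_esum _ _ _ setT _ (fun n => n.+1%:Z)); split.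
  - by move=> n _ /=; split => //; split.
  - by move=> n p _ _ [].
  - by move=> [[|n]|n] [[_ /= k0] kp]//; exists n.
apply: (@reindex_esum _ _ _ setT _ (fun n => - n.+1%:Z)); split.
- by move=> n _ /=; split => //; split.
- by move=> n p _ _ /= /oppr_inj [].
- by move=> [[|n]|n] [[_ /= k0] kp]//; exists n.
Qed.

(** * Zeta sums and Korobov weights *)

Section zeta_sums.
Variable R : realType.
Implicit Types x : R.

(** A discrete integral test: the right side telescopes. With [p = x - 1] and [q] the ratio of the
    two integers, it follows from [expR (p * ln q) >= 1 + p * ln q] and [ln q >= 1 / n.+2]. *)
Lemma powRN_succ_le x n : 1 < x ->
  (x - 1) * n.+2%:R `^ (- x) <= n.+1%:R `^ (1 - x) - n.+2%:R `^ (1 - x) :> R.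
Proof.
move=> x1; set p := x - 1; have p0 : 0 < p by rewrite subr_gt0.
have -> : 1 - x = - p by rewrite opprB.
have -> : - x = - p + - 1 by rewrite /p; ring.
have a0 : 0 < n.+1%:R :> R by [].
have b0 : 0 < n.+2%:R :> R by [].
have aE : n.+1%:R `^ (- p)
    = n.+2%:R `^ (- p) * expR (p * ln (n.+2%:R / n.+1%:R)) :> R.
  rewrite /powR !gt_eqF// -expRD; congr expR.
  by rewrite lnM ?posrE ?invr_gt0// lnV ?posrE//; ring.
have -> : n.+2%:R `^ (- p + - 1) = n.+2%:R `^ (- p) * n.+2%:R^-1 :> R.
  by rewrite powRD ?powR_inv1// pnatr_eq0 implybT.
rewrite aE mulrCA -[X in _ - X]mulr1 -mulrBr.
rewrite ler_pM2l ?powR_gt0// lerBrDl.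
apply: le_trans (expR_ge1Dx _); rewrite lerD2l ler_pM2l//.
have := @le_ln1Dx R (- n.+2%:R^-1).
have -> : 1 + - n.+2%:R^-1 = (n.+2%:R / n.+1%:R)^-1 :> R.
  have bN0 : n.+2%:R != 0 :> R by rewrite gt_eqF.
  rewrite invf_div; apply: (mulIf bN0); rewrite mulrBl mulVf// divfK// mul1r.
  by rewrite -[n.+2]addn1 natrD addrK.
rewrite lnV ?posrE ?divr_gt0// lerN2; apply.
by rewrite ltrN2 invf_lt1// ltr1n.
Qed.

Lemma cvg_zeta x : 1 < x -> cvgn (series (fun n : nat => n.+1%:R `^ (- x))).
Proof.
move=> x1; have p0 : 0 < x - 1 by rewrite subr_gt0.
apply: nondecreasing_is_cvgn.
  by apply: nondecreasing_series => n _ _; rewrite powR_ge0.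
exists (1 + (x - 1)^-1) => _ [[|n] _ <-].
  by rewrite /series/= big_nil addr_ge0 ?invr_ge0 1?ltW.
(* The sharper bound, with the telescoped remainder kept, is the one that passes through the
   induction. *)
apply: le_trans (_ : 1 + (x - 1)^-1 * (1 - n.+1%:R `^ (1 - x)) <= _); last first.
  by rewrite lerD2l ler_piMr ?invr_ge0 1?ltW// gerBl powR_ge0.
elim: n => [|n IH].
  by rewrite /series/= big_nat1 !powR1 subrr mulr0 addr0.
rewrite /series/= big_nat_recr//=.
apply: le_trans (lerD IH (lexx _)) _; rewrite -addrA lerD2l.
rewrite -[n.+2%:R `^ (- x)](mulKf (lt0r_neq0 p0)) -mulrDr ler_pM2l ?invr_gt0//.
by have := powRN_succ_le n x1; lra.
Qed.

Lemma esum_zeta x : 1 < x ->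
  \esum_(n in [set: nat]) (n.+1%:R `^ (- x))%:E = (zeta x)%:E.
Proof.
move=> x1; rewrite -nneseries_esumT; last by move=> n; rewrite lee_fin powR_ge0.
rewrite /zeta -EFin_lim; last exact: cvg_zeta.
by apply: congr_lim; apply/funext => n /=; rewrite /series/= sumEFin.
Qed.

Lemma zeta_ge0 x : 1 < x -> 0 <= zeta x.
Proof.
move=> x1; rewrite -lee_fin -esum_zeta//.
by apply: esum_ge0 => n _; rewrite lee_fin powR_ge0.
Qed.

(** The value 0 at [k = 0] lets sums over nonzero integers run over all of [int]. *)
Definition absN x (k : int) : R := if k == 0 then 0 else (`|k|%:~R `^ x)^-1.

Lemma absN_ge0 x k : 0 <= absN x k.
Proof. by rewrite /absN; case: ifP => // _; rewrite invr_ge0 powR_ge0. Qed.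

Lemma esum_absN x : 1 < x ->
  \esum_(k in [set: int]) (absN x k)%:E = (2 * zeta x)%:E.
Proof.
move=> x1; rewrite esum_int => [|k]; last by rewrite lee_fin absN_ge0.
rewrite /absN eqxx add0e mulr_natl mulr2n EFinD -esum_zeta//.
by congr (_ + _)%E; apply: eq_esum => n _; rewrite powRN.
Qed.

Lemma korobov_r1E (alpha gamma : R) k :
  korobov_r1 alpha gamma k = if k == 0 then 1 else gamma * absN alpha k.
Proof. by rewrite /korobov_r1 /absN; case: ifP. Qed.

Lemma korobov_r1_ge0 (alpha gamma : R) k :
  0 <= gamma -> 0 <= korobov_r1 alpha gamma k.
Proof.
by move=> g0; rewrite korobov_r1E; case: ifP => // _; rewrite mulr_ge0 ?absN_ge0.
Qed.

Lemma powR_absN x l k : 0 < l -> absN x k `^ l = absN (x * l) k.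
Proof.
move=> l0; rewrite /absN; case: ifP => _; first by rewrite powR0 ?gt_eqF.
by rewrite -powRN -!powRrM mulNr powRN.
Qed.

Lemma powR_korobov_r1 (alpha gamma l : R) k : 0 < l -> 0 <= gamma ->
  korobov_r1 alpha gamma k `^ l = korobov_r1 (alpha * l) (gamma `^ l) k.
Proof.
move=> l0 g0; rewrite !korobov_r1E; case: ifP => _; first by rewrite powR1.
by rewrite powRM ?absN_ge0// powR_absN.
Qed.

Lemma powR_prod (I : finType) (P : pred I) (F : I -> R) l :
  (forall i, P i -> 0 <= F i) ->
  (\prod_(i | P i) F i) `^ l = \prod_(i | P i) F i `^ l.
Proof.
move=> F0; suff [] : (\prod_(i | P i) F i) `^ l = \prod_(i | P i) F i `^ l
    /\ 0 <= \prod_(i | P i) F i by [].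
apply: (big_rec2 (fun a b => b `^ l = a /\ 0 <= b)); first by rewrite powR1.
by move=> i a b Pi [<- b0]; rewrite powRM ?mulr_ge0// F0.
Qed.

Lemma powR_korobov_r (alpha l : R) gamma d (h : d.-tuple int) : 0 < l ->
  (forall j, 0 <= gamma j) ->
  korobov_r alpha gamma h `^ l
  = korobov_r (alpha * l) (fun j => gamma j `^ l) h.
Proof.
move=> l0 g0; rewrite /korobov_r powR_prod; last by move=> j _; rewrite korobov_r1_ge0.
by apply: eq_bigr => j _; rewrite powR_korobov_r1.
Qed.

Lemma korobov_r_ge0 (alpha : R) gamma d (h : d.-tuple int) :
  (forall j, 0 <= gamma j) -> 0 <= korobov_r alpha gamma h.
Proof. by move=> g0; apply: prodr_ge0 => j _; rewrite korobov_r1_ge0. Qed.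

Lemma korobov_r_rcons (alpha : R) gamma d (h : d.-tuple int) k :
  korobov_r alpha gamma [tuple of rcons h k]
  = korobov_r alpha gamma h * korobov_r1 alpha (gamma d) k.
Proof.
rewrite /korobov_r big_ord_recr/=; congr (_ * korobov_r1 _ _ _).
  apply: eq_bigr => j _; rewrite !(tnth_nth 0)/= nth_rcons size_tuple.
  by rewrite (ltn_ord j).
by rewrite (tnth_nth 0)/= nth_rcons size_tuple ltnn eqxx.
Qed.

Lemma esum_tuple0 (T : choiceType) (f : 0.-tuple T -> \bar R) :
  (forall h, (0 <= f h)%E) -> \esum_(h in [set: 0.-tuple T]) f h = f [tuple].
Proof.
move=> f0; rewrite [X in esum X](_ : _ = [set [tuple]]) ?esum_set1//.
by apply/seteqP; split => h _ //=; rewrite tuple0.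
Qed.

Lemma esum_tuple_rcons (T : choiceType) d (f : d.+1.-tuple T -> \bar R) :
  (forall h, (0 <= f h)%E) ->
  \esum_(h in [set: d.+1.-tuple T]) f h
  = \esum_(h in [set: d.-tuple T]) \esum_(k in [set: T]) f [tuple of rcons h k].
Proof.
move=> f0; rewrite esum_esum//.
pose e (p : d.-tuple T * T) : d.+1.-tuple T := [tuple of rcons p.1 p.2].
apply: (@reindex_esum _ _ _ _ _ e f); split => //.
- move=> [h k] [h' k'] _ _ /(congr1 val)/= /rcons_inj [hh' ->].
  by congr pair; exact: val_inj.
- move=> h _; case/tupleP: h => x t; exists ([tuple of belast x t], last x t) => //.
  by apply: val_inj; rewrite /= -lastI.
Qed.
End zeta_sums.
(** * Averaging over the search space *)

(* A solution [c] is coprime to [n], so [gcd(k, n) = gcd(a, n)], and [c] is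
   determined modulo [n / gcd(k, n)]. *)
Lemma card_congruence (K n : nat) (A : {set 'I_K}) (a k : int) : (0 < n)%N ->
  (forall c, c \in A -> (c < n)%N && coprime c n) ->
  (#|[set c in A | (n %| (a + c%:Z * k)%R)%Z]%SET| <=
   if (gcdn (absz a) n %| absz k)%N then gcdn (absz a) n else 0)%N.
Proof.
move=> n0 An; set g := gcdn _ _; set B := [set c in A | _]%SET.
have [->|[c0]] := set_0Vmem B; first by rewrite cards0.
rewrite inE => /andP[/An /andP[c0n cop0] dvd0].
have g0 : (0 < g)%N by rewrite gcdn_gt0 n0 orbT.
have gn : (g %| n)%N by exact: dvdn_gcdr.
have ga : (g %| a)%Z by rewrite dvdzE/= dvdn_gcdl.
have gk : (g %| k)%Z.
  have : (g %| (c0%:Z * k)%R)%Z.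
    have : (g %| (a + c0%:Z * k)%R)%Z by apply: dvdz_trans dvd0; rewrite dvdzE.
    by rewrite rpredDl.
  by rewrite Gauss_dvdzr// coprimezE/= coprime_sym (coprime_dvdr gn).
have gkN : (g %| absz k)%N by rewrite dvdzE in gk.
rewrite gkN.
have gcdE : gcdn (absz k) n = g.
  apply/eqP; rewrite eqn_dvd [X in _ && X]dvdn_gcd gn andbT.
  apply/andP; split; last exact: gkN.
  rewrite dvdn_gcd dvdn_gcdr andbT.
  have : ((gcdn (absz k) n)%:Z %| (a + c0%:Z * k)%R)%Z.
    by apply: dvdz_trans dvd0; rewrite dvdzE/= dvdn_gcdr.
  by rewrite rpredDr ?dvdz_mull// dvdzE/= dvdn_gcdl.
pose q := (n %/ g)%N; have qg : (q * g = n)%N by rewrite divnK.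
have q0 : (0 < q)%N by rewrite divn_gt0// dvdn_leq.
have gZ0 : (g%:Z != 0) by rewrite eqz_nat -lt0n.
have modq c : c \in B -> (c %% q = c0 %% q)%N.
  rewrite inE => /andP[_ dvdc].
  have : (n %| ((c%:Z - c0%:Z) * k)%R)%Z.
    have -> : (c%:Z - c0%:Z) * k = (a + c%:Z * k) - (a + c0%:Z * k) by ring.
    exact: rpredB.
  rewrite -qg -(divzK gk) mulrA PoszM dvdz_mul2r ?gZ0// Gauss_dvdzl; last first.
    rewrite coprimezE/= /coprime -(eqn_pmul2r g0) mul1n muln_gcdl qg.
    have -> : (absz (k %/ g)%Z * g)%N = absz k by rewrite -{2}(divzK gk) abszM.
    by rewrite gcdnC gcdE.
  by rewrite -eqz_mod_dvd => /eqP; rewrite !modz_nat => -[].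
(* Since [c < n = q * g] and the residue of [c] modulo [q] is fixed, the quotient [c %/ q] takes
   fewer than [g + 1] values and determines [c]. The successor form of [g] is what [inord] asks
   for. *)
have gS : g = g.-1.+1 by rewrite prednK.
have fP (c : 'I_K) : c \in B -> (c %/ q < g.-1.+1)%N.
  by rewrite inE -gS ltn_divLR// mulnC qg => /andP[/An /andP[]].
have -> : g = #|'I_g.-1.+1| by rewrite card_ord -gS.
rewrite -(@card_in_imset _ _ (fun c : 'I_K => inord (c %/ q) : 'I_g.-1.+1) B).
  exact: max_card.
move=> c c' cB c'B /(congr1 val)/=; rewrite !inordK ?fP// => divE.
by apply: val_inj; rewrite /= (divn_eq c q) (divn_eq c' q) divE !modq.
Qed.

Section average.
Variable R : realType.
Implicit Types x : R.

(** Substituting [k = g * k'] turns a term into [g ^ (1 - x) * |k'| ^ (- x)], and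
    [g ^ (1 - x) <= 1]. The multiplicity [g] of solutions of a congruence is thus paid for by the
    sparsity of the multiples of [g]. *)
Lemma esum_absN_dvd x g : 1 < x -> (0 < g)%N ->
  (\esum_(k in [set: int]) (if (g %| absz k)%N then g%:R * absN x k else 0)%:E
   <= (2 * zeta x)%:E)%E.
Proof.
move=> x1 g0; rewrite -esum_absN//.
pose f (k : int) := (g%:R * absN x k)%:E.
rewrite (_ : esum _ _ = \esum_(k in [set k : int | (g %| absz k)%N]) f k); last first.
  rewrite [RHS]esum_mkcond; apply: eq_esum => k _.
  by rewrite /f; have [dk|dk] := boolP (g %| absz k)%N;
   [rewrite mem_set|rewrite memNset//; apply/negP].
rewrite (@reindex_esum _ _ _ setT _ (fun k => g%:Z * k) f); last first.
  split.
  - by move=> k _ /=; rewrite abszM dvdn_mulr.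
  - by move=> k k' _ _; apply: mulfI; rewrite eqz_nat -lt0n.
  - move=> k /= gk; exists (k %/ g)%Z => //; rewrite mulrC divzK//.
apply: le_esum => k _; rewrite lee_fin /f /absN mulf_eq0 eqz_nat gtn_eqF//=.
case: ifP => k0; first by rewrite mulr0.
rewrite normrM intrM powRM ?ler0n ?ler0z// ger0_norm// invfM mulrA.
rewrite ler_piMl ?invr_ge0 ?powR_ge0// ler_pdivrMr ?powR_gt0 ?ltr0n// mul1r.
by rewrite le1r_powR ?ler1n// ltW.
Qed.

Lemma search_space_unit b m w (c : 'I_(b ^ m)) : (w < m)%N ->
  c \in search_space b m w -> (c < b ^ (m - w))%N && coprime c (b ^ (m - w)).
Proof.
move=> wm; rewrite /search_space wm inE => /andP[/andP[_ ->]].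
by rewrite coprime_pexpr ?(leq_ltn_trans _ wm)// coprime_pexpr ?subn_gt0.
Qed.

(** For [m <= w] the truncated difference is 0 and [totient 1 = 1] matches the singleton search
    space, so no case distinction is needed in the bound. *)
Lemma card_search_space b m w : prime b -> (0 < m)%N ->
  #|search_space b m w| = totient (b ^ (m - w)).
Proof.
move=> pb m0; have b1 := prime_gt1 pb; have b0 := prime_gt0 pb.
have bm1 : (1 < b ^ m)%N by rewrite -(expn0 b) ltn_exp2l.
rewrite /search_space; case: ltnP => wm; last first.
  move: (wm); rewrite -subn_eq0 => /eqP ->; rewrite expn0.
  rewrite (_ : [set z | _]%SET = [set Ordinal bm1]%SET) ?cards1//.
  by apply/setP => z; rewrite !inE -val_eqE.
have leM : (b ^ (m - w) <= b ^ m)%N by rewrite leq_exp2l// leq_subr.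
rewrite totient_count_coprime big_mkord -sum1_card.
under eq_bigl => z.
  rewrite inE coprime_pexpr// -(@coprime_pexpr (m - w)) ?subn_gt0// coprime_sym.
  have -> : ((0 < z < b ^ (m - w)) && coprime (b ^ (m - w)) z
      = (z < b ^ (m - w)) && coprime (b ^ (m - w)) z)%N.
    case: posnP => //= ->; rewrite /coprime gcdn0 gtn_eqF ?andbF//.
    by rewrite -(expn0 b) ltn_exp2l// subn_gt0.
  over.
transitivity (\sum_(i < b ^ (m - w) | coprime (b ^ (m - w)) i) 1)%N; last first.
  by rewrite big_mkcond; apply: eq_bigr => i _; case: coprime.
rewrite (big_ord_widen_cond _ (fun z => coprime (b ^ (m - w)) z) (fun=> 1%N) leM).
by apply: eq_bigl => z; rewrite andbC.
Qed.

(** If [b ^ w] does not divide [a], the congruence has no solution. Otherwise it is divided by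
    [b ^ w], and [card_congruence] applies modulo [b ^ (m - w)]. The bound is independent of the
    size of the search space, so a mean over the space gains that size as a denominator. *)
Lemma sum_search_space x b m w (a : int) : 1 < x -> (0 < b)%N -> (w < m)%N ->
  (\sum_(c in search_space b m w) \esum_(k in [set: int])
     (if ((b ^ m)%N%:Z %| (a + (b ^ w * c)%:Z * k)%R)%Z
      then absN x k else 0)%:E <= (2 * zeta x)%:E)%E.
Proof.
move=> x1 b0 wm.
rewrite -esum_sum; last by move=> k c _ _; rewrite lee_fin; case: ifP; rewrite ?absN_ge0.
have bE : (b ^ m)%N%:Z = (b ^ w)%N%:Z * (b ^ (m - w))%N%:Z.
  by rewrite -PoszM -expnD subnKC// ltnW.
have bw0 : (b ^ w)%N%:Z != 0 by rewrite eqz_nat -lt0n expn_gt0 b0.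
have [|nwa] := boolP ((b ^ w)%N%:Z %| a)%Z; last first.
  rewrite esum1 ?lee_fin ?mulr_ge0 ?zeta_ge0// => k _.
  rewrite big1// => c _; rewrite bE ifF//; apply: contraNF nwa => dvd.
  have : ((b ^ w)%N%:Z %| (a + (b ^ w * c)%:Z * k)%R)%Z.
    by apply: dvdz_trans dvd; rewrite dvdz_mulr.
  by rewrite rpredDr// PoszM -mulrA dvdz_mulr.
move=> /dvdzP[a' ->].
set n := (b ^ (m - w))%N in bE *; set g := gcdn (absz a') n.
have n0 : (0 < n)%N by rewrite expn_gt0 b0.
have g0 : (0 < g)%N by rewrite gcdn_gt0 n0 orbT.
apply: le_trans (esum_absN_dvd x1 g0); apply: le_esum => k _.
rewrite sumEFin lee_fin -big_mkcondr /= sumr_const -[leLHS]mulr_natl.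
rewrite (_ : #|_| = #|[set c in search_space b m w | (n %| (a' + c%:Z * k)%R)%Z]%SET|).
  have := @card_congruence _ n (search_space b m w) a' k n0
    (fun c => @search_space_unit b m w c wm).
  rewrite -/g; case: ifP => gk h.
    by rewrite ler_wpM2r ?absN_ge0// ler_nat.
  by move: h; rewrite leqn0 => /eqP ->; rewrite mul0r.
apply: eq_card => c; rewrite !inE; congr (_ && _).
rewrite bE (_ : a' * _ + _ = (b ^ w)%N%:Z * (a' + c%:Z * k)) ?dvdz_mul2l//.
by rewrite PoszM; ring.
Qed.
End average.
(** * Sums over the dual lattice *)

Section dual_sum.
Variable R : realType.
Implicit Types (al : R) (ga : nat -> R).

Definition lattice_dot (d : nat) (z : d.-tuple nat) (h : d.-tuple int) : int :=
  \sum_(j < d) (tnth z j)%:Z * tnth h j.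

(** The zero vector is included and contributes 1, hence the squared error is this sum minus 1. *)
Definition dual_sum al ga (N d : nat) (z : d.-tuple nat) : \bar R :=
  \esum_(h in [set: d.-tuple int])
    (if (N%:Z %| lattice_dot z h)%Z then korobov_r al ga h else 0)%:E.

(* The part of [dual_sum] for the vector [rcons z c] carried by the [h] with a
   nonzero last entry; [absN al 0 = 0] discards the others. *)
Definition theta al ga (N d : nat) (z : d.-tuple nat) (c : nat) : \bar R :=
  \esum_(h in [set: d.-tuple int]) \esum_(k in [set: int])
    (if (N%:Z %| (lattice_dot z h + c%:Z * k)%R)%Z
     then korobov_r al ga h * (ga d * absN al k) else 0)%:E.

Lemma lattice_dot_rcons d (z : d.-tuple nat) (h : d.-tuple int) c k :
  lattice_dot [tuple of rcons z c] [tuple of rcons h k] = lattice_dot z h + c%:Z * k.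
Proof.
rewrite /lattice_dot big_ord_recr/=; congr (_ + _%:Z * _).
- apply: eq_bigr => j _; rewrite (tnth_nth 0%N) (tnth_nth 0) [tnth z j](tnth_nth 0%N).
  by rewrite [tnth h j](tnth_nth 0) /= !nth_rcons !size_tuple ltn_ord.
- by rewrite (tnth_nth 0%N)/= nth_rcons size_tuple ltnn eqxx.
- by rewrite (tnth_nth 0)/= nth_rcons size_tuple ltnn eqxx.
Qed.

Lemma esum_delta (T : choiceType) (t : T) (f : T -> R) : 0 <= f t ->
  \esum_(i in [set: T]) (if i == t then f i else 0)%:E = (f t)%:E.
Proof.
move=> ft; rewrite (esumID [set t]); last by move=> i _; rewrite lee_fin; case: eqP => // ->.
rewrite setTI esum_set1 ?eqxx ?lee_fin// setTI esum1 ?adde0// => i /=.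
by case: eqP => // ->.
Qed.

Lemma esum_korobov_r1 al (g : R) : 1 < al -> 0 <= g ->
  \esum_(k in [set: int]) (korobov_r1 al g k)%:E = (1 + g * (2 * zeta al))%:E.
Proof.
move=> a1 g0.
under eq_esum => k _.
  rewrite (_ : _%:E = ((if k == 0 then 1 else 0)%:E + g%:E * (absN al k)%:E)%E); last first.
    rewrite -EFinM -EFinD korobov_r1E; have [->|_] := eqVneq k 0; last by rewrite add0r.
    by rewrite /absN eqxx mulr0 addr0.
  over.
rewrite /= esumD; last 2 first.
- by move=> k _; case: eqP; rewrite lee_fin.
- by move=> k _; rewrite -EFinM lee_fin mulr_ge0// absN_ge0.
rewrite (@esum_delta _ (0 : int) (fun=> 1))// esumZl//; last first.
  by move=> k; rewrite lee_fin absN_ge0.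
by rewrite esum_absN.
Qed.

Lemma esum_korobov_r al ga d : 1 < al -> (forall j, 0 <= ga j) ->
  \esum_(h in [set: d.-tuple int]) (korobov_r al ga h)%:E
  = (\prod_(j < d) (1 + ga j * (2 * zeta al)))%:E.
Proof.
move=> a1 g0; have kr0 n (h : n.-tuple int) : (0 <= (korobov_r al ga h)%:E)%E.
  by rewrite lee_fin korobov_r_ge0.
elim: d => [|d IH]; first by rewrite esum_tuple0// /korobov_r !big_ord0.
rewrite esum_tuple_rcons// big_ord_recr/= EFinM -IH muleC -esumZl//; last first.
  by rewrite addr_ge0 ?mulr_ge0 ?zeta_ge0.
apply: eq_esum => h _; rewrite -esum_korobov_r1// muleC.
rewrite -esumZl ?korobov_r_ge0//; last by move=> k; rewrite lee_fin korobov_r1_ge0.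
by apply: eq_esum => k _; rewrite korobov_r_rcons EFinM.
Qed.

Variables (al : R) (ga : nat -> R).
Hypotheses (a1 : 1 < al) (g0 : forall j, 0 <= ga j).

Let Z : R := 2 * zeta al.
Let U d : R := \prod_(j < d) (1 + ga j * Z).

Let Z0 : 0 <= Z. Proof. by rewrite mulr_ge0 ?zeta_ge0. Qed.

Let gZ0 d : 0 <= ga d * Z. Proof. by rewrite mulr_ge0. Qed.

Let U0 d : 0 <= U d.
Proof. by rewrite /U; apply: prodr_ge0 => j _; rewrite addr_ge0// mulr_ge0. Qed.

Let kr0 d (h : d.-tuple int) : 0 <= korobov_r al ga h.
Proof. exact: korobov_r_ge0. Qed.

Let f0 (P : bool) d (h : d.-tuple int) k :
  0 <= if P then korobov_r al ga h * (ga d * absN al k) else 0.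
Proof. by case: P; rewrite ?mulr_ge0 ?absN_ge0. Qed.

Lemma theta_ge0 N d (z : d.-tuple nat) c : (0 <= theta al ga N z c)%E.
Proof. by apply: esum_ge0 => h _; apply: esum_ge0 => k _; rewrite lee_fin. Qed.

(** Dropping the congruence leaves a product of one-dimensional sums. Besides finiteness, this
    yields the bound for a component equal to 0, where no averaging takes place. *)
Lemma theta_le N d (z : d.-tuple nat) c : (theta al ga N z c <= (U d * (ga d * Z))%:E)%E.
Proof.
rewrite /theta mulrC EFinM -(@esum_korobov_r al ga d)//.
rewrite -esumZl//; last by move=> h; rewrite lee_fin.
apply: le_esum => h _.
rewrite muleC -[X in (_ * X)%E]/((ga d)%:E * Z%:E)%E -(esum_absN a1) -!esumZl//.
- by apply: le_esum => k _; rewrite -!EFinM lee_fin; case: ifP; rewrite ?mulr_ge0 ?absN_ge0.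
- by move=> k; rewrite -EFinM lee_fin mulr_ge0 ?absN_ge0.
- by move=> k; rewrite lee_fin absN_ge0.
Qed.

Lemma theta_lty N d (z : d.-tuple nat) c : (theta al ga N z c < +oo)%E.
Proof. by apply: le_lt_trans (theta_le _ _ _) _; rewrite ltry. Qed.

Lemma dual_sum_lty N d (z : d.-tuple nat) : (dual_sum al ga N z < +oo)%E.
Proof.
apply: (@le_lt_trans _ _ (U d)%:E); last exact: ltry.
by rewrite -esum_korobov_r//; apply: le_esum => h _; rewrite lee_fin; case: ifP.
Qed.

Lemma dual_sum_rcons N d (z : d.-tuple nat) c :
  dual_sum al ga N [tuple of rcons z c] = (dual_sum al ga N z + theta al ga N z c)%E.
Proof.
rewrite /dual_sum esum_tuple_rcons; last by move=> h; rewrite lee_fin; case: ifP.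
rewrite /theta -esumD; last 2 first.
- by move=> h _; rewrite lee_fin; case: ifP.
- by move=> h _; apply: esum_ge0 => k _; rewrite lee_fin.
apply: eq_esum => h _.
set A := (if _ then korobov_r al ga h else 0).
have A0 : 0 <= A by rewrite /A; case: ifP.
(* The term without a last entry is written as a family in [k] supported at 0, so that both sides
   can be compared for each [k]. *)
rewrite -[A%:E](@esum_delta _ (0 : int) (fun=> A))// -esumD; last 2 first.
- by move=> k _; case: eqP; rewrite lee_fin.
- by move=> k _; rewrite lee_fin.
apply: eq_esum => k _; rewrite -EFinD lattice_dot_rcons korobov_r_rcons korobov_r1E.
congr EFin; have [->|k0] := eqVneq k 0; last by rewrite add0r.
by rewrite mulr1 mulr0 addr0 /absN eqxx !mulr0 if_same addr0.
Qed.

(** [sum_search_space] is uniform in its offset, so it can be used for each [h] with the offset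
    [lattice_dot z h]. *)
Lemma sum_theta b m w d (z : d.-tuple nat) : (0 < b)%N -> (w < m)%N ->
  (\sum_(c in search_space b m w) theta al ga (b ^ m) z (b ^ w * c) <=
   (U d * (ga d * Z))%:E)%E.
Proof.
move=> b0 wm; rewrite /theta -esum_sum; last first.
  by move=> h c _ _; apply: esum_ge0 => k _; rewrite lee_fin.
rewrite mulrC EFinM -(@esum_korobov_r al ga d)// -esumZl//; last by move=> h; rewrite lee_fin.
apply: le_esum => h _.
rewrite muleC -[X in (_ * X)%E]/((ga d)%:E * Z%:E)%E muleA.
apply: le_trans (lee_wpmul2l _ (sum_search_space (lattice_dot z h) a1 b0 wm)); last first.
  by rewrite -EFinM lee_fin mulr_ge0.
rewrite ge0_sume_distrr; last first.
  by move=> c _; apply: esum_ge0 => k _; rewrite lee_fin; case: ifP; rewrite ?absN_ge0.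
apply: lee_sum => c _; rewrite -EFinM -esumZl ?mulr_ge0//; last first.
  by move=> k; rewrite lee_fin; case: ifP; rewrite ?absN_ge0.
by apply: le_esum => k _; rewrite -EFinM lee_fin; case: ifP; rewrite ?mulr0// mulrA.
Qed.

End dual_sum.

(** Jensen's inequality [powR_esum_le] is applied once, to the family indexed by the pairs
    [(h, k)]. *)
Lemma theta_powR (R : realType) (al l : R) (ga : nat -> R) N d (z : d.-tuple nat) c :
  1 < al -> 0 < l <= 1 -> (forall j, 0 <= ga j) ->
  ((fine (theta al ga N z c) `^ l)%:E
   <= theta (al * l) (fun j => (ga j `^ l)%R) N z c)%E.
Proof.
move=> a1 l01 g0; have l0 : 0 < l by case/andP: l01.
pose f a g (p : d.-tuple int * int) : R :=
  if (N%:Z %| (lattice_dot z p.1 + c%:Z * p.2)%R)%Z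
  then korobov_r a g p.1 * (g d * absN a p.2) else 0.
have f0 a g p : (forall j, 0 <= g j) -> 0 <= f a g p.
  move=> g1; rewrite /f; case: ifP => // _.
  by rewrite mulr_ge0 ?korobov_r_ge0// mulr_ge0// absN_ge0.
have thetaE a g : (forall j, 0 <= g j) ->
    theta a g N z c = \esum_(p in [set: d.-tuple int * int]) (f a g p)%:E.
  move=> g1; rewrite /theta (@esum_esum _ _ _ _ _ (fun h k => (f a g (h, k))%:E)).
    rewrite (_ : _ `*`` _ = setT); last by apply/seteqP.
    by apply: eq_esum => -[].
  by move=> h k _ _; rewrite lee_fin f0.
have := theta_lty a1 g0 N z c; rewrite !thetaE// => [|j]; last exact: powR_ge0.
move=> /(powR_esum_le l01) => /(_ (fun p => f0 _ _ _ g0)) /le_trans; apply.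
apply: le_esum => -[h k] _; rewrite lee_fin /f/=; case: ifP => _.
  by rewrite !powRM ?mulr_ge0 ?absN_ge0 ?korobov_r_ge0// powR_korobov_r// powR_absN.
by rewrite powR0 ?gt_eqF.
Qed.

(** The minimal value is at most the mean over the [#|S| - #|E|] admissible candidates;
    nonnegativity then extends the sum to all of [S], where [sum_theta] applies. Exclusion thus
    costs the factor [#|S| / (#|S| - #|E|)] only. *)
Lemma theta_step (R : realType) (al l : R) (ga : nat -> R) (b m w d : nat)
    (z : d.-tuple nat) (E : {set 'I_(b ^ m)}) (c : 'I_(b ^ m)) :
  prime b -> (0 < m)%N -> (w < m)%N -> 1 < al -> 0 < l <= 1 -> 1 < al * l ->
  (forall j, 0 <= ga j) ->
  E \proper search_space b m w ->
  (forall c', c' \in search_space b m w :\: E ->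
    fine (theta al ga (b ^ m) z (b ^ w * c))
    <= fine (theta al ga (b ^ m) z (b ^ w * c'))) ->
  fine (theta al ga (b ^ m) z (b ^ w * c)) `^ l <=
  (totient (b ^ (m - w)))%:R^-1
  * (#|search_space b m w|%:R / (#|search_space b m w|%:R - #|E|%:R))
  * (ga d `^ l * (2 * zeta (al * l)))
  * \prod_(j < d) (1 + ga j `^ l * (2 * zeta (al * l))).
Proof.
move=> pb m0 wm a1 l01 al1 g0 Epr cmin; have b0 := prime_gt0 pb.
(* Going to the totient and back turns the leading [totient] into [#|S|], which then cancels against
   the numerator. *)
rewrite (card_search_space _ pb m0) -(card_search_space w pb m0).
set S := search_space b m w in Epr cmin *.
have ltES : (#|E| < #|S|)%N by exact: proper_card.
have S0 : 0 < #|S|%:R :> R by rewrite ltr0n (leq_ltn_trans _ ltES).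
have D0 : 0 < #|S|%:R - #|E|%:R :> R by rewrite subr_gt0 ltr_nat.
set th := fine (theta _ _ _ _ _).
have th0 : 0 <= th by rewrite fine_ge0// theta_ge0.
rewrite mulrA mulVf ?gt_eqF// mul1r -mulrA -ler_pdivrMl ?invr_gt0// invrK.
have -> : #|S|%:R - #|E|%:R = #|S :\: E|%:R :> R.
  by rewrite cardsDS ?proper_sub// natrB// ltnW.
rewrite -lee_fin [_ * \prod_(_ < _) _]mulrC.
apply: le_trans (sum_theta (ga := fun j => (ga j `^ l)%R) al1 _ z b0 wm); last first.
  by move=> j; exact: powR_ge0.
rewrite -/S (big_setID E)/= addeC.
apply: (@le_trans _ _ (\sum_(c' in S :\: E)
    theta (al * l) (fun j => (ga j `^ l)%R) (b ^ m) z (b ^ w * c'))%E); last first.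
  by rewrite leeDl// sume_ge0// => c' _; apply: theta_ge0 => j; exact: powR_ge0.
rewrite mulr_natl -sumr_const -sumEFin; apply: lee_sum => c' c'SE.
apply: le_trans (theta_powR _ _ _ a1 l01 g0).
rewrite lee_fin ge0_ler_powR ?nnegrE//; first by case/andP: l01 => /ltW.
- by rewrite fine_ge0// theta_ge0.
- exact: cmin.
Qed.
(** * The component-by-component induction *)

Section subsets.

Definition widen_set d (u : {set 'I_d}) : {set 'I_d.+1} :=
  [set widen_ord (leqnSn d) i | i in u]%SET.

Lemma widen_ordS_inj d : injective (widen_ord (leqnSn d)).
Proof. by move=> i j /(congr1 val) ij; exact: val_inj. Qed.

Lemma ord_max_widen d (u : {set 'I_d}) : ord_max \notin widen_set u.
Proof.
apply/imsetP => -[i _ /(congr1 val)/= dE].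
by move: (ltn_ord i); rewrite -dE ltnn.
Qed.

Lemma sum_set_ordS (V : nmodType) d (F : {set 'I_d.+1} -> V) :
  \sum_u F u = \sum_(u : {set 'I_d}) F (widen_set u)
             + \sum_(u : {set 'I_d}) F (ord_max |: widen_set u)%SET.
Proof.
pose narrow (v : {set 'I_d.+1}) := [set i | widen_ord (leqnSn d) i \in v]%SET.
have widenK u : narrow (widen_set u) = u.
  apply/setP => i; rewrite inE mem_imset//; exact: widen_ordS_inj.
have narrowK (v : {set 'I_d.+1}) : ord_max \notin v -> widen_set (narrow v) = v.
  move=> dv; apply/setP => j; apply/imsetP/idP => [ [i ] | jv].
    by rewrite inE => iv ->.
  have jd : (j < d)%N.
    rewrite ltn_neqAle -ltnS ltn_ord andbT; apply: contraNneq dv => jd.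
    by rewrite (_ : ord_max = j)//; apply: val_inj.
  exists (Ordinal jd); last exact: val_inj.
  by rewrite inE (_ : widen_ord _ _ = j)//; exact: val_inj.
rewrite (bigID (fun u : {set _} => ord_max \notin u))/=; congr (_ + _).
  rewrite (reindex_onto (@widen_set d) narrow) => [|v]; last exact: narrowK.
  by apply: eq_bigl => u; rewrite ord_max_widen widenK eqxx.
rewrite (reindex_onto (fun u => ord_max |: widen_set u)%SET
  (fun v => narrow (v :\ ord_max)%SET)).
  apply: eq_bigl => u; rewrite setU1K ?ord_max_widen// widenK eqxx andbT.
  by rewrite negbK setU11.
move=> v; rewrite negbK => dv; rewrite narrowK ?finset.setD1K//.
by rewrite setD11.
Qed.

Lemma sum_prod_subset (R : comNzRingType) d (G : nat -> R) :
  \sum_(u : {set 'I_d}) \prod_(j in u) G j = \prod_(j < d) (1 + G j).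
Proof.
elim: d => [|d IH].
  rewrite big_ord0 (bigD1 finset.set0)//= big_set0 big1 ?addr0// => u /eqP[].
  by apply/setP => -[].
rewrite sum_set_ordS big_ord_recr/= mulrDr mulr1 -IH; congr (_ + _).
  apply: eq_bigr => u _; rewrite big_imset//= => i j _ _; exact: widen_ordS_inj.
rewrite mulr_suml; apply: eq_bigr => u _.
rewrite big_setU1 ?ord_max_widen//= mulrC big_imset//= => i j _ _.
exact: widen_ordS_inj.
Qed.

(** A subset that contains the last index [d] has maximum [w d] by monotonicity, so its denominator
    is constant; the remaining sum over subsets factors into a product. This matches the increment
    of the error when one component is added. *)
Lemma sum_subset_max (R : fieldType) d (w : nat -> nat) (G f : nat -> R) :
  (forall j, (w j <= w j.+1)%N) ->
  \sum_(u : {set 'I_d.+1}) (\prod_(j in u) G j) / f (\max_(j in u) w j)%N =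
  \sum_(u : {set 'I_d}) (\prod_(j in u) G j) / f (\max_(j in u) w j)%N
  + G d / f (w d) * \prod_(j < d) (1 + G j).
Proof.
move=> wS; have wm := homo_leq (@leqnn) leq_trans wS.
rewrite sum_set_ordS; congr (_ + _).
  apply: eq_bigr => u _; rewrite !big_imset//= => i j _ _; exact: widen_ordS_inj.
rewrite -sum_prod_subset mulr_sumr; apply: eq_bigr => u _.
rewrite !big_setU1 ?ord_max_widen//= !big_imset/=; last 2 first.
- by move=> i j _ _; exact: widen_ordS_inj.
- by move=> i j _ _; exact: widen_ordS_inj.
rewrite (maxn_idPl _); first by rewrite mulrAC.
by apply/bigmax_leqP => i _; apply: wm; exact: ltnW.
Qed.

End subsets.

Section cbc.
Variables (R : realType) (al l : R) (ga : nat -> R) (b m : nat) (w : nat -> nat).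
Hypotheses (pb : prime b) (m0 : (0 < m)%N) (w0 : w 0%N = 0%N).
Hypotheses (wS : forall j, (w j <= w j.+1)%N).
Hypotheses (a1 : 1 < al) (g0 : forall j, 0 <= ga j) (l01 : 0 < l <= 1).
Hypothesis al1 : 1 < al * l.
Variables (e2 : forall d, d.-tuple nat -> \bar R).
Hypothesis e2E : forall d (z : d.-tuple nat),
  e2 z = (dual_sum al ga (b ^ m) z - 1)%E.
Variables (s : nat) (E : nat -> {set 'I_(b ^ m)}) (z : nat -> 'I_(b ^ m)).
Variable zt : nat -> nat.
Hypothesis cbc : combined_cbc (fun d (y : d.-tuple nat) => e2 y) w s E z zt.

Let F j : R := #|search_space b m (w j)|%:R
  / (#|search_space b m (w j)|%:R - #|E j|%:R).
Let zd d := [tuple zt i | i < d].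

Let e2_ext d c : e2 (extend zt d c)
  = (dual_sum al ga (b ^ m) (zd d) - 1 + theta al ga (b ^ m) (zd d) c)%E.
Proof. by rewrite e2E dual_sum_rcons// addeAC. Qed.

Let zdS d : zd d.+1 = extend zt d (zt d).
Proof.
apply: eq_from_tnth => j.
rewrite tnth_mktuple (tnth_nth 0%N)/= nth_rcons size_map size_enum_ord.
have := ltn_ord j; rewrite ltnS leq_eqVlt => /predU1P[->|jd]; first by rewrite ltnn eqxx.
by rewrite jd (nth_map (Ordinal jd)) ?size_enum_ord// nth_enum_ord.
Qed.

Let S_fin d (y : d.-tuple nat) : dual_sum al ga (b ^ m) y \is a fin_num.
Proof.
rewrite fin_numElt dual_sum_lty// andbT (lt_le_trans (ltNyr 0))//.
by apply: esum_ge0 => h _; rewrite lee_fin; case: ifP => // _; exact: korobov_r_ge0.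
Qed.

Let th_fin d (y : d.-tuple nat) c : theta al ga (b ^ m) y c \is a fin_num.
Proof. by rewrite fin_numElt theta_lty// andbT (lt_le_trans (ltNyr 0))// theta_ge0. Qed.

(** With no earlier component the congruence is [c * k = 0], which is the same for every unit
    [c]. *)
Lemma theta_unit (y : 0.-tuple nat) c : coprime c (b ^ m) ->
  theta al ga (b ^ m) y c = theta al ga (b ^ m) y 1.
Proof.
move=> cb; rewrite /theta; apply: eq_esum => h _; apply: eq_esum => k _.
by rewrite /lattice_dot big_ord0 !add0r mul1r Gauss_dvdzr// coprimezE coprime_sym.
Qed.

Lemma one_search_space (c : 'I_(b ^ m)) : c = 1%N :> nat -> c \in search_space b m 0.
Proof.
move=> c1; rewrite /search_space m0 inE c1 subn0 coprime1n andbT.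
by rewrite -(expn0 b) ltn_exp2l// prime_gt1.
Qed.

Lemma proper_exclusion d : (d < s)%N -> E d \proper search_space b m (w d).
Proof.
case: cbc => z1 _ E0 cbcS ds.
have sub0 (S : {set 'I_(b ^ m)}) c : c \in S -> finset.set0 \proper S.
  by move=> cS; rewrite finset.proper0; apply/set0Pn; exists c.
case: d ds => [_|d ds]; first by rewrite E0 w0; apply/sub0/one_search_space/z1.
have := cbcS d.+1 ds; case: ltnP => [_ []//|wm [-> _ _]].
(* For [m <= w] the search space is the singleton of 1, and [z 0] is an ordinal of value 1. *)
by apply: (sub0 _ (z 0%N)); rewrite /search_space ltnNge wm inE z1.
Qed.

(** Allows the factors [F j] of the earlier components to be inserted into the product, where
    [cbc_theta_step] has only [F d]. *)
Lemma cbc_F_ge1 d : (d < s)%N -> 1 <= F d.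
Proof.
move=> /proper_exclusion/proper_card ES.
rewrite ler_pdivlMr ?subr_gt0 ?ltr_nat// mul1r gerBl ler0n//.
Qed.

Lemma cbc_theta_step d : (d < s)%N ->
  fine (theta al ga (b ^ m) (zd d) (zt d)) `^ l <=
  (totient (b ^ (m - w d)))%:R^-1 * F d * (ga d `^ l * (2 * zeta (al * l)))
  * \prod_(j < d) (1 + ga j `^ l * (2 * zeta (al * l))).
Proof.
move=> ds; have Epr := proper_exclusion ds.
case: cbc => z1 zt1 E0 cbcS.
(* The first component is prescribed rather than minimized; by [theta_unit] all candidates give the
   same [theta], so 1 is a minimizer and [theta_step] still applies. *)
have [dE|d0] := posnP d.
  subst d; have -> : zt 0%N = (b ^ (w 0%N) * z 0%N)%N by rewrite w0 mul1n z1.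
  apply: theta_step => //; first by rewrite w0.
  move=> c'; rewrite inE w0 mul1n => /andP[_ c'S].
  have copr (c : 'I_(b ^ m)) : c \in search_space b m 0 -> coprime c (b ^ m).
    by rewrite /search_space m0 inE => /andP[].
  by rewrite mul1n !theta_unit ?copr// one_search_space.
have := cbcS d; rewrite d0 ds => /(_ isT); case: ltnP => [wm|wm].
  case=> _ zS zmin ->; apply: theta_step => // c' c'S.
  (* The squared error and [theta] differ by a finite quantity fixed before this step, so they have
     the same minimizers. *)
  have := zmin c' c'S; rewrite !e2_ext leeD2lE; last by rewrite fin_numB S_fin.
  by move=> ?; apply: fine_le.
(* A zero component puts no condition on the last entry. Here [m - w d = 0] makes the totient 1 and
   the empty exclusion set makes [F d = 1], so [theta_le] is enough. *)
case=> Ed _ ->.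
have -> : F d = 1.
  rewrite /F Ed cards0 subr0 divff// (card_search_space _ pb m0) pnatr_eq0.
  by rewrite -lt0n totient_gt0 expn_gt0 prime_gt0.
move: (wm); rewrite -subn_eq0 => /eqP ->; rewrite (_ : totient (b ^ 0) = 1%N)//.
rewrite invr1 !mul1r mulrC -lee_fin; have gl0 j : 0 <= ga j `^ l by exact: powR_ge0.
exact: le_trans (theta_powR _ _ _ a1 l01 g0) (theta_le al1 gl0 _ _ _).
Qed.

Lemma cbc_e2_bound d : (d <= s)%N ->
  fine (e2 (zd d)) `^ l <= \sum_(u : {set 'I_d})
         (\prod_(j in u) (ga j `^ l * (4 * zeta (al * l)) * F j))
         / (totient (b ^ (m - \max_(j in u) w j)))%:R.
Proof.
have l0 : 0 < l by case/andP: l01.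
have z0 : 0 <= zeta (al * l) by exact: zeta_ge0.
elim: d => [_|d IH ds].
  have -> : fine (e2 (zd 0)) = 0.
    rewrite e2E /dual_sum esum_tuple0 => [|h]; last first.
      by rewrite lee_fin; case: ifP => // _; exact: korobov_r_ge0.
    by rewrite /lattice_dot big_ord0 dvdz0 /korobov_r big_ord0 subee.
  rewrite powR0 ?gt_eqF//; apply: sumr_ge0 => u _; rewrite divr_ge0 ?ler0n//.
  by apply: prodr_ge0 => -[].
rewrite (@sum_subset_max R d w (fun j => ga j `^ l * (4 * zeta (al * l)) * F j)
  (fun x => (totient (b ^ (m - x)))%:R) wS).
(* The zero vector alone contributes 1 to [dual_sum]; nonnegativity is needed for subadditivity of
   the power. *)
have e20 : 0 <= fine (e2 (zd d)).
  rewrite e2E fineB// subr_ge0; set h0 := [tuple 0 | _ < d] : d.-tuple int.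
  have h0E j : tnth h0 j = 0 by rewrite tnth_mktuple.
  have h0dual : lattice_dot (zd d) h0 = 0 by apply: big1 => j _; rewrite h0E mulr0.
  have kr1 : korobov_r al ga h0 = 1 by apply: big1 => j _; rewrite h0E /korobov_r1 eqxx.
  have := @lee_esum_subset _ _ (fun h : d.-tuple int => (if ((b ^ m)%N%:Z %| lattice_dot (zd d) h)%Z
    then korobov_r al ga h else 0)%:E) [set h0] setT.
  rewrite esum_set1 h0dual dvdz0 kr1 ?lee_fin// => S1; apply: fine_le => //.
  apply: S1 => // h; rewrite lee_fin; case: ifP => // _; exact: korobov_r_ge0.
rewrite zdS e2_ext fineD//; last by rewrite fin_numB S_fin.
rewrite -e2E; apply: le_trans (powR_add_le l01 e20 _) _; first by rewrite fine_ge0// theta_ge0.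
apply: lerD; first exact/IH/ltnW.
apply: le_trans (cbc_theta_step ds) _.
have gl0 j : 0 <= ga j `^ l by exact: powR_ge0.
have F0 j : (j < s)%N -> 0 <= F j by move=> /cbc_F_ge1; apply: le_trans.
apply: ler_pM.
- apply: mulr_ge0; last by rewrite !mulr_ge0.
  by apply: mulr_ge0; [rewrite invr_ge0 ler0n|exact: F0].
- by apply: prodr_ge0 => j _; rewrite addr_ge0// !mulr_ge0.
(* The step gives [2 * zeta] and the claim has [4 * zeta]: the difference is the smaller side once
   more. *)
- set c := (_%:R)^-1; have c0 : 0 <= c by rewrite invr_ge0 ler0n.
  rewrite -subr_ge0 (_ : _ - _ = 2 * (c * F d * ga d `^ l * zeta (al * l))); last by ring.
  by do 4!apply: mulr_ge0 => //; exact: F0.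
apply: ler_prod => j _; have js : (j < s)%N by exact: ltn_trans (ltn_ord j) ds.
rewrite addr_ge0 ?mulr_ge0//= lerD2l -mulrA ler_wpM2l//.
apply: le_trans (_ : 4 * zeta (al * l) <= _); first by rewrite ler_wpM2r// ler_nat.
by rewrite ler_peMr ?mulr_ge0// cbc_F_ge1.
Qed.
End cbc.
(** * Riesz representation *)

Section hilbert.
Local Open Scope complex_scope.
Variables (R : realType) (V : lmodType R[i]) (dot : {dot V for Num.conj}).
Local Notation Re := complex.Re.
Local Notation Im := complex.Im.

Definition sqnorm (u : V) : R := Re (dot u u).

Lemma dot_conj u v : dot u v = Num.conj (dot v u).
Proof. by rewrite hermC mul1r. Qed.

Lemma Re_dotC u v : Re (dot u v) = Re (dot v u).
Proof. by rewrite dot_conj; case: (dot v u). Qed.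

Lemma sqnorm_ge0 u : 0 <= sqnorm u.
Proof.
have := dnorm_ge0 dot u; rewrite /sqnorm; case: (dot u u) => a c.
by rewrite lecE => /andP[].
Qed.

Lemma dot_sqnorm u : dot u u = (sqnorm u)%:C.
Proof.
have := dnorm_ge0 dot u; rewrite /sqnorm; case: (dot u u) => a c.
by rewrite lecE => /andP[/eqP /= ->].
Qed.

Lemma Re_mulC (t : R) (x : R[i]) : Re (t%:C * x) = t * Re x.
Proof. by case: x => a c /=; rewrite mul0r subr0. Qed.

Lemma sqnormD u v : sqnorm (u + v) = sqnorm u + sqnorm v + 2 * Re (dot u v).
Proof.
rewrite /sqnorm linearDl !linearDr !raddfD/= [Re (dot v u)]Re_dotC; ring.
Qed.

Lemma sqnormN u : sqnorm (- u) = sqnorm u.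
Proof. by rewrite /sqnorm linearNl linearNr opprK. Qed.

Lemma Re_dotZl (t : R) u v : Re (dot (t%:C *: u) v) = t * Re (dot u v).
Proof. by rewrite linearZl_LR Re_mulC. Qed.

Lemma sqnormZ (t : R) u : sqnorm (t%:C *: u) = t ^+ 2 * sqnorm u.
Proof.
by rewrite /sqnorm Re_dotZl Re_dotC Re_dotZl expr2 mulrA.
Qed.

Lemma sqnorm_eq0 u : sqnorm u = 0 -> u = 0.
Proof.
move=> u0; apply/eqP; rewrite -(dnorm_eq0 dot) dot_sqnorm u0; exact/eqP.
Qed.

Lemma normc_ge0 (x : R[i]) : 0 <= Normc.normc x.
Proof. by case: x => a c; exact: sqrtr_ge0. Qed.

Lemma normc_sqr (x : R[i]) : Normc.normc x ^+ 2 = Re x ^+ 2 + Im x ^+ 2.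
Proof. by case: x => a c; rewrite /= sqr_sqrtr// addr_ge0 ?sqr_ge0. Qed.

Lemma cauchy_schwarz u v :
  Normc.normc (dot u v) ^+ 2 <= sqnorm u * sqnorm v.
Proof.
have [v0|v0] := eqVneq (sqnorm v) 0.
  by rewrite (sqnorm_eq0 v0) linear0r /sqnorm linear0r mulr0 normc_sqr/= expr0n addr0.
have vp : 0 < sqnorm v by rewrite lt_neqAle eq_sym v0 sqnorm_ge0.
pose a := dot u v / dot v v.
have ou : dot (u - a *: v) v = 0.
  rewrite linearBl/= linearZl_LR/= divfK ?subrr// dot_sqnorm.
  by rewrite (inj_eq (@complexI _)).
have := sqnorm_ge0 (u - a *: v); rewrite {1}/sqnorm linearBr/= linearZr_LR/= ou mulr0 subr0.
rewrite linearBl/= raddfB/= -/(sqnorm u) linearZl_LR/= subr_ge0.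
rewrite (dot_conj v) /a dot_sqnorm -ler_pdivrMr// normc_sqr.
case: (dot u v) => x y /=.
rewrite mul0r oppr0 !mulr0 subr0 add0r expr0n addr0.
by rewrite (_ : _ - _ = (x ^+ 2 + y ^+ 2) / sqnorm v)//; field.
Qed.

Lemma sqnorm_parallelogram u v :
  sqnorm (u - v) = 2 * sqnorm u + 2 * sqnorm v - 4 * sqnorm ((2^-1)%:C *: (u + v)).
Proof.
by rewrite sqnormZ !sqnormD sqnormN linearNr raddfN/=; field.
Qed.

Hypothesis complete : forall u : nat -> V,
  (forall e : R, 0 < e -> exists n0 : nat, forall p q : nat,
     (n0 <= p)%N -> (n0 <= q)%N -> sqnorm (u p - u q) < e) ->
  exists v : V, forall e : R, 0 < e ->
    exists n0 : nat, forall p : nat, (n0 <= p)%N -> sqnorm (u p - v) < e.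

(* The representing vector minimizes [J u = |u|^2 - 2 Re (L u)]; a minimizing
   sequence is Cauchy by the parallelogram identity. *)
Lemma riesz (L : V -> R[i]) (C : R) : scalar L -> 0 <= C ->
  (forall u, Re (L u) ^+ 2 <= C * sqnorm u) -> exists v, forall u, L u = dot u v.
Proof.
move=> Ls C0 LC.
have LZ a u : L (a *: u) = a * L u.
  have L0 : L 0 = 0.
    have := Ls 1 0 0; rewrite scaler0 addr0 mul1r.
    by move=> h; apply: (addrI (L 0)); rewrite addr0 -h.
  by have := Ls a u 0; rewrite !addr0 L0 addr0.
have LD u v : L (u + v) = L u + L v by rewrite -[u]scale1r Ls LZ !mul1r.
pose J u := sqnorm u - 2 * Re (L u).
have J_lb u : - C <= J u.
  have := LC u; have := sqnorm_ge0 u; rewrite /J; move: (Re (L u)) (sqnorm u) => x n n0 xC.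
  rewrite leNgt; apply/negP => h.
  (* If [n + C < 2 * x], then [(n + C)^2 < 4 * x^2 <= 4 * C * n], against [(n - C)^2 >= 0]. *)
  have : (n + C) ^+ 2 < (2 * x) ^+ 2 by rewrite ltr_pXn2r ?nnegrE//; lra.
  by have := sqr_ge0 (n - C); nra.
have hJ : has_inf (range J).
  by split; [exists (J 0), 0|exists (- C) => _ [u _ <-]].
set mu := inf (range J).
have mu_le u : mu <= J u by apply: ge_inf; [case: hJ|exists u].
have /choice[u uP] : forall n : nat, exists u, J u < mu + n.+1%:R^-1.
  move=> n; have n0 : 0 < n.+1%:R^-1 :> R by [].
  have [_ [u _ <-] ltu] := inf_adherent n0 hJ.
  by exists u.
have small (e : R) : 0 < e -> exists n0 : nat, forall n, (n0 <= n)%N -> n.+1%:R^-1 < e.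
  move=> e0; exists (Num.bound e^-1) => n n0n.
  rewrite invf_plt ?posrE//; apply: lt_le_trans (archi_boundP _) _; first by rewrite invr_ge0 ltW.
  by rewrite ler_nat ltnW.
have [e e0|v vP] := @complete u.
  have [|n0 n0P] := small (e / 4); first by rewrite divr_gt0.
  exists n0 => p q /n0P np /n0P nq; rewrite sqnorm_parallelogram.
  have := mu_le ((2^-1)%:C *: (u p + u q)); rewrite {1}/J LZ Re_mulC LD raddfD/=.
  have := uP p; have := uP q; rewrite /J.
  move: np nq; move: (p.+1%:R^-1) (q.+1%:R^-1) => ep eq.
  lra.
have varJ f : Re (L f) = Re (dot f v).
  set D := Re (dot f v) - Re (L f).
  have nf := sqnorm_ge0 f.
  (* First-order condition along [f], from [mu <= J (u n + t f)]. Replacing [u n] by [v] in the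
     cross term uses [|u n - v - t f|^2 >= 0]; this is the origin of the second [t^2 |f|^2]. *)
  have D_ge t : 0 <= 2 * t * D + 2 * t ^+ 2 * sqnorm f.
    rewrite leNgt; apply/negP => Dt.
    set e := 2 * t * D + _ in Dt.
    have e0 : 0 < - e / 2 by rewrite divr_gt0// oppr_gt0.
    have [n1 n1P] := small _ e0; have [n2 n2P] := vP _ e0.
    set n := maxn n1 n2.
    have h1 := n1P n (leq_maxl _ _); have h2 := n2P n (leq_maxr _ _).
    have h3 := mu_le (u n + t%:C *: f); have h4 := uP n.
    rewrite /J LD LZ raddfD/= Re_mulC sqnormD sqnormZ [Re (dot (u n) _)]Re_dotC Re_dotZl in h3.
    have h5 := sqnorm_ge0 (u n - v - t%:C *: f).
    rewrite sqnormD sqnormN sqnormZ linearNr raddfN/= in h5.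
    rewrite [Re (dot (u n - v) _)]Re_dotC Re_dotZl linearBr/= raddfB/= in h5.
    move: h1 h2 h3 h4 h5; rewrite {1}/J /e /D.
    move: (n.+1%:R^-1) => i h1 h2 h3 h4 h5.
    by lra.
  (* Nearly the minimizing [t]; the added 1 avoids dividing by 0 when [f] has norm 0. *)
  have := D_ge (- D / (2 * (sqnorm f + 1))).
  have -> : 2 * (- D / (2 * (sqnorm f + 1))) * D
      + 2 * (- D / (2 * (sqnorm f + 1))) ^+ 2 * sqnorm f
     = - (D ^+ 2 * ((sqnorm f + 2) / (2 * (sqnorm f + 1) ^+ 2))).
    by field; lra.
  have c0 : 0 < (sqnorm f + 2) / (2 * (sqnorm f + 1) ^+ 2).
    by rewrite divr_gt0 ?mulr_gt0 ?exprn_gt0//; lra.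
  rewrite oppr_ge0 pmulr_lle0// => D2.
  have : D ^+ 2 == 0 by rewrite eq_le D2 sqr_ge0.
  by rewrite sqrf_eq0 subr_eq0 => /eqP.
exists v => f; apply/eqP; rewrite eq_complex varJ eqxx/=; apply/eqP.
(* The imaginary parts agree because the real parts do at [i f]. *)
have := varJ ((0 +i* 1) *: f); rewrite LZ linearZl_LR/=.
case: (L f) (dot f v) => [x y] [x' y'] /=; rewrite !mul0r !mul1r !sub0r.
exact: oppr_inj.
Qed.

End hilbert.
(** * Lebesgue measure on the cube *)

Section cube.
Variable R : realType.
Local Notation mu d := (cube_measure R d).
Local Notation RT d := (d.-tuple R).

Lemma measurable_box d (A : 'I_d -> set R) : (forall j, measurable (A j)) ->
  measurable [set x : d.-tuple R | forall j, A j (tnth x j)].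
Proof.
move=> mA.
rewrite (_ : mkset _ = \bigcap_(j in [set: 'I_d]) (tnth (T:=R) ^~ j @^-1` A j)).
  apply: fin_bigcap_measurable => // j _; rewrite -[X in measurable X]setTI.
  exact: measurable_tnth.
by apply/seteqP; split => x /= xA j; [move=> _; exact: xA|exact: xA].
Qed.

Lemma measurable_cube d : measurable (cube R d).
Proof.
have := @measurable_box d (fun=> `[0, 1]%classic) (fun=> measurable_itv _).
by congr measurable; apply/seteqP; split => x /= xc j; have := xc j; rewrite in_itv.
Qed.

Lemma cube_measure_tonelli d (g : RT d.+1 -> \bar R) :
  measurable_fun setT g -> (forall x, (0 <= g x)%E) ->
  (\int[mu d.+1]_x g x =
   \int[lebesgue_measure]_(t in `[0%R, 1%R]) \int[mu d]_x g [tuple of t :: x])%E.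
Proof.
move=> mg g0 /=; have mgc : measurable_fun setT (g \o @tcons R d).
  by apply: measurableT_comp => //; exact: measurable_tcons.
rewrite ge0_integral_distribution// fubini_tonelli1//; last by move=> x /=.
rewrite integral_uniform//; last 2 first.
- by apply: measurable_fun_fubini_tonelli_F => // x /=.
- by move=> t; apply: integral_ge0 => x _ /=.
by rewrite subr0 invr1 mul1e.
Qed.

Lemma cube_measure_cube d : mu d (cube R d) = 1%E.
Proof.
elim: d => [|d IH]; first by rewrite /= diracE mem_set//= => -[].
rewrite -(setIT (cube R d.+1)) -integral_indic//; last exact: measurable_cube.
rewrite cube_measure_tonelli//; last first.
  by apply/measurable_EFinP; apply: measurable_indic; exact: measurable_cube.
transitivity (\int[lebesgue_measure]_(t in `[0%R, 1%R]) (cst 1 t : \bar R))%E; last first.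
  by rewrite integral_cst//= lebesgue_measure_itv/= lte01 oppr0 adde0 mule1.
apply: eq_integral => t; rewrite inE/= in_itv/= => t01.
rewrite -IH -[in RHS](setIT (cube R d)) -integral_indic//; last exact: measurable_cube.
apply: eq_integral => x _; rewrite !indicE; congr (_%:R%:E); congr nat_of_bool.
apply/idP/idP; rewrite !inE => xc j.
  by have := xc (lift ord0 j); rewrite tnthS.
by case: (unliftP ord0 j) => [i ->|->]; [rewrite tnthS|rewrite tnth0].
Qed.

Lemma cosD2piz (x : R) (k : int) : cos (x + k%:~R * (2 * pi)) = cos x.
Proof.
have pE n : n%:R * (2 * pi) = pi *+ 2 *+ n :> R by rewrite mulr_natl [2 * _]mulr_natl.
case: k => n; first by rewrite pE periodicn//; exact: cosD2pi.
by rewrite NegzE mulrNz mulNr -[LHS](periodicn (@cosD2pi R) n.+1) -pE subrK.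
Qed.

Lemma sinD2piz (x : R) (k : int) : sin (x + k%:~R * (2 * pi)) = sin x.
Proof. by rewrite -!cosBpihalf addrAC cosD2piz. Qed.

Lemma integral_cos_itv (c : R) (k : int) :
  (\int[lebesgue_measure]_(t in `[0%R, 1%R]) (1 + cos (c + 2 * pi * k%:~R * t))%:E
   = (1 + if k == 0 then cos c else 0)%:E)%E.
Proof.
have [->|k0] := eqVneq k 0.
  under eq_integral do rewrite mulr0 mul0r addr0.
  by rewrite integral_cst//= lebesgue_measure_itv/= lte01 oppr0 adde0 mule1.
set a : R := 2 * pi * k%:~R.
have a0 : a != 0 by rewrite !mulf_neq0// ?intr_eq0// gt_eqF// pi_gt0.
pose F (t : R) : R := t + a^-1 * sin (c + a * t).
have dF (t : R) : is_derive t 1 F (1 + cos (c + a * t)).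
  have d1 : is_derive t (1 : R) (fun t : R => c + a * t) a.
    by apply: is_derive_eq; rewrite add0r mul1r [LHS]mulr1.
  rewrite /F; apply: is_derive_eq.
  by rewrite [_ *: _]mulrCA mulVf ?mulr1.
have cF : continuous F.
  by move=> t; apply/differentiable_continuous/derivable1_diffP; apply: ex_derive.
rewrite (@continuous_FTC2 _ _ F)//; last 3 first.
- apply: continuous_subspaceT => t; apply/differentiable_continuous/derivable1_diffP.
  by apply: ex_derive.
- split; first by move=> t _; apply: ex_derive.
    exact/cvg_at_right_filter/cF.
  exact/cvg_at_left_filter/cF.
- by move=> t _; rewrite derive1E; apply: derive_val.
rewrite -EFinB /F mulr1 mulr0 add0r (_ : c + a = c + k%:~R * (2 * pi)); last by rewrite mulrC.
by rewrite sinD2piz !addr0 addrK.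
Qed.

(** * Orthogonality of characters on the cube *)

Definition phase d (h : d.-tuple int) (x : d.-tuple R) : R :=
  \sum_(j < d) (tnth h j)%:~R * tnth x j.

Lemma measurable_phase d (h : d.-tuple int) : measurable_fun setT (@phase d h).
Proof.
apply: measurable_sum => j; apply: measurable_funM => //; exact: measurable_tnth.
Qed.

Lemma measurable_cos_phase d (h : d.-tuple int) (c : R) :
  measurable_fun setT (fun x : d.-tuple R => cos (c + 2 * pi * phase h x)).
Proof.
apply: measurableT_comp; first by apply: continuous_measurable_fun; exact: continuous_cos.
apply: measurable_funD => //; apply: measurable_funM => //; exact: measurable_phase.
Qed.

(* Adding 1 makes the integrand nonnegative, so that Tonelli applies. *)
Lemma integral_cos_phase d (h : d.-tuple int) (c : R) :
  (\int[mu d]_x (1 + cos (c + 2 * pi * phase h x))%:E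
   = (1 + if [forall j, tnth h j == 0] then cos c else 0)%:E)%E.
Proof.
have cos_ge x : 0 <= 1 + cos x :> R by rewrite -lerBlDl sub0r cos_geN1.
have m1cos n (k : n.-tuple int) a :
    measurable_fun setT (fun x : n.-tuple R => (1 + cos (a + 2 * pi * phase k x))%:E).
  by apply/measurable_EFinP/measurable_funD => //; exact: measurable_cos_phase.
elim: d h c => [|d IH] h c.
  rewrite integral_dirac//=; last exact: m1cos.
  rewrite ?diracT ?mul1e /phase big_ord0 mulr0 addr0.
  by case: ifPn => // /forallPn[] [].
rewrite cube_measure_tonelli//.
case/tupleP: h => k h.
have phaseS (t : R) (x : d.-tuple R) :
    phase [tuple of k :: h] [tuple of t :: x] = k%:~R * t + phase h x.
  rewrite /phase big_ord_recl !tnth0; congr (_ + _); apply: eq_bigr => j _.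
  by rewrite !tnthS.
under eq_integral => t _.
  under eq_integral do rewrite phaseS mulrDr addrA.
  rewrite IH.
  over.
rewrite /=; set B := [forall j, tnth h j == 0].
have -> : [forall j, tnth [tuple of k :: h] j == 0] = (k == 0) && B.
  apply/forallP/andP => [h0|[h0 /forallP h0'] j].
    split; first by have := h0 ord0; rewrite tnth0.
    by apply/forallP => j; have := h0 (lift ord0 j); rewrite tnthS.
  by case: (unliftP ord0 j) => [i ->|->]; rewrite ?tnthS ?tnth0.
case: B; last first.
  under eq_integral do rewrite addr0.
  rewrite andbF addr0 integral_cst//= lebesgue_measure_itv/= lte01 oppr0 adde0.
  by rewrite mule1.
rewrite andbT -integral_cos_itv; apply: eq_integral => t _.
by rewrite -[in RHS]mulrA.
Qed.

End cube.
(** * The Korobov kernel *)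

(** Pointwise, [max(f, 0) + g = max(- f, 0) + (g + f)]. Adding a summable majorant replaces the
    positive and negative parts by nonnegative terms that are affine in [f]. *)
Lemma rsumE (R : realType) (I : choiceType) (f g : I -> R) :
  (forall i, `|f i| <= g i) -> (\esum_(i in [set: I]) (g i)%:E < +oo)%E ->
  rsum f = fine (\esum_(i in [set: I]) (g i + f i)%:E)
           - fine (\esum_(i in [set: I]) (g i)%:E).
Proof.
move=> fg goo; have gf i : 0 <= g i by rewrite (le_trans _ (fg i)).
have fin h : (forall i, 0 <= h i <= 2 * g i) -> \esum_(i in [set: I]) (h i)%:E \is a fin_num.
  move=> hg; have h0 i : 0 <= h i by case/andP: (hg i).
  rewrite fin_numElt (lt_le_trans (ltNyr 0))/=; last first.
    by apply: esum_ge0 => i _; rewrite lee_fin.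
  apply: (@le_lt_trans _ _ (2%:E * \esum_(i in [set: I]) (g i)%:E)%E).
    rewrite -esumZl//; apply: le_esum => i _.
    by rewrite -EFinM lee_fin; case/andP: (hg i).
  by rewrite lte_mul_pinfty.
rewrite /rsum.
have finN : \esum_(i in [set: I]) (Num.max (- f i) 0)%:E \is a fin_num.
  apply: fin => i; have := fg i; rewrite ler_norml => /andP[? ?].
  by have [?|?] := leP (- f i) 0; apply/andP; split; lra.
have finP : \esum_(i in [set: I]) (Num.max (f i) 0)%:E \is a fin_num.
  apply: fin => i; have := fg i; rewrite ler_norml => /andP[? ?].
  by have [?|?] := leP (f i) 0; apply/andP; split; lra.
have fing : \esum_(i in [set: I]) (g i)%:E \is a fin_num.
  by apply: fin => i; have := gf i => ?; apply/andP; split; lra.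
have fingf : \esum_(i in [set: I]) (g i + f i)%:E \is a fin_num.
  apply: fin => i; have := fg i; rewrite ler_norml => /andP[? ?].
  by apply/andP; split; lra.
suff : (\esum_(i in [set: I]) (Num.max (f i) 0)%:E + \esum_(i in [set: I]) (g i)%:E
     = \esum_(i in [set: I]) (Num.max (- f i) 0)%:E
       + \esum_(i in [set: I]) (g i + f i)%:E)%E.
  by move=> /(congr1 fine); rewrite !fineD//; lra.
rewrite -!esumD//; try by move=> i _; rewrite lee_fin ?le_max ?lexx ?orbT//;
  have := fg i; rewrite ler_norml => /andP[? ?]; lra.
apply: eq_esum => i _; rewrite -!EFinD; congr EFin.
by have [?|?] := leP (f i) 0; have [?|?] := leP (- f i) 0; lra.
Qed.

(** Turns an unordered sum into a series, the form in which measurability of sums and exchange with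
    integrals are available. *)
Lemma esum_countable (R : realType) (T : countType) (a : T -> \bar R) :
  (forall t, (0 <= a t)%E) ->
  \esum_(t in [set: T]) a t = (\sum_(0 <= n <oo) oapp a 0%E (pickle_inv n))%E.
Proof.
move=> a0; rewrite nneseries_esumT; last by move=> n; case: pickle_inv => /=.
pose b n := oapp a 0%E (pickle_inv n).
rewrite -[RHS]/(\esum_(n in [set: nat]) b n) (esumID (range (@pickle T))); last first.
  by move=> n _; rewrite /b; case: pickle_inv => /=.
rewrite setTI [X in (_ + X)%E]esum1 ?adde0; last first.
  move=> n [_ /= nT]; rewrite /b; have := @pickle_invK T n.
  by case: pickle_inv => //= t tn; exfalso; apply: nT; exists t.
rewrite esum_image; last by move=> t u _ _; exact: (pcan_inj pickleK).
by apply: eq_esum => t _; rewrite /b pickleK_inv.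
Qed.

Section kernel.
Variables (R : realType) (al : R) (ga : nat -> R).
Hypotheses (a1 : 1 < al) (g0 : forall j, 0 <= ga j).
Variable d : nat.
Local Notation Re := complex.Re.
Local Notation Im := complex.Im.
Local Notation mu := (cube_measure R d).
Local Notation r h := (korobov_r al ga h).

(** The value of the kernel on the diagonal, hence the squared norm of each kernel function. *)
Definition kappa : R := fine (\esum_(h in [set: d.-tuple int]) (r h)%:E).

Let r0 (h : d.-tuple int) : 0 <= r h. Proof. exact: korobov_r_ge0. Qed.

Let r0E (h : d.-tuple int) : (0 <= (r h)%:E)%E. Proof. by rewrite lee_fin. Qed.

Lemma kappaE : \esum_(h in [set: d.-tuple int]) (r h)%:E = kappa%:E.
Proof. by rewrite /kappa esum_korobov_r. Qed.

Lemma cosD1_ge0 (t : R) : 0 <= 1 + cos t.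
Proof. by rewrite -lerBlDl sub0r cos_geN1. Qed.

(* The real and imaginary parts of the kernel are [cos_esum - kappa] for suitable
   phases [c]; adding 1 to the cosine makes every term nonnegative. *)
Definition cos_esum (c : d.-tuple int -> R) (x : d.-tuple R) : \bar R :=
  \esum_(h in [set: d.-tuple int]) (r h * (1 + cos (c h + 2 * pi * phase h x)))%:E.

Let term0 (c : d.-tuple int -> R) x (h : d.-tuple int) :
  (0 <= (r h * (1 + cos (c h + 2 * pi * phase h x)))%:E)%E.
Proof. by rewrite lee_fin mulr_ge0// cosD1_ge0. Qed.

Lemma cos_esum_ge0 c x : (0 <= cos_esum c x)%E.
Proof. by apply: esum_ge0. Qed.

Lemma cos_esum_le c x : (cos_esum c x <= (2 * kappa)%:E)%E.
Proof.
rewrite EFinM -kappaE -esumZl//; apply: le_esum => h _.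
by rewrite -EFinM lee_fin mulrC ler_wpM2r//; have := cos_le1 (c h + 2 * pi * phase h x); lra.
Qed.

Lemma cos_esum_fin c x : cos_esum c x \is a fin_num.
Proof.
rewrite fin_numElt (lt_le_trans (ltNyr 0) (cos_esum_ge0 _ _))/=.
by rewrite (le_lt_trans (cos_esum_le _ _))// ltry.
Qed.

Lemma rsum_cos (t : d.-tuple int -> R) c x :
  (forall h, cos (t h) = cos (c h + 2 * pi * phase h x)) ->
  rsum (fun h : d.-tuple int => r h * cos (t h)) = fine (cos_esum c x) - kappa.
Proof.
move=> tE; rewrite (@rsumE _ _ _ (fun h => r h)); last 2 first.
- by move=> h; rewrite normrM (ger0_norm (r0 h)) ler_piMr// ler_norml cos_geN1 cos_le1.
- by rewrite kappaE ltry.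
congr (fine _ - _); apply: eq_esum => h _.
by rewrite -tE mulrDr mulr1.
Qed.

Definition phase_re (y : d.-tuple R) (h : d.-tuple int) : R := - (2 * pi * phase h y).
(** The shift by [pi / 2] writes the sine as a cosine, so that both parts of the kernel are
    instances of [cos_esum]. *)
Definition phase_im (y : d.-tuple R) (h : d.-tuple int) : R := phase_re y h - pi / 2.

Lemma phase_sub (h : d.-tuple int) (x y : d.-tuple R) :
  2 * pi * \sum_(j < d) (tnth h j)%:~R * (tnth x j - tnth y j)
  = phase_re y h + 2 * pi * phase h x.
Proof.
rewrite addrC /phase_re -mulrBr; congr (_ * _); rewrite /phase -sumrB.
by apply: eq_bigr => j _; rewrite mulrBr.
Qed.

Lemma Re_kernel (x y : cube R d) :
  Re (korobov_kernel al ga x y)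
  = fine (cos_esum (phase_re (set_val y)) (set_val x)) - kappa.
Proof.
rewrite /korobov_kernel /csum /=; apply: etrans (rsum_cos _); last by [].
by congr rsum; apply/funext => h /=; rewrite mul0r subr0 phase_sub.
Qed.

Lemma Im_kernel (x y : cube R d) :
  Im (korobov_kernel al ga x y)
  = fine (cos_esum (phase_im (set_val y)) (set_val x)) - kappa.
Proof.
rewrite /korobov_kernel /csum /=.
rewrite -(@rsum_cos (fun h => 2 * pi * \sum_(j < d) (tnth h j)%:~R *
  (tnth (set_val x) j - tnth (set_val y) j) - pi / 2)).
  congr rsum; apply/funext => h /=; rewrite mul0r addr0 cosBpihalf//.
by move=> h; rewrite phase_sub /phase_im addrAC.
Qed.

Lemma measurable_cos_esum c : measurable_fun setT (cos_esum c).
Proof.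
rewrite (_ : cos_esum c = (fun x => \sum_(0 <= n <oo)
    oapp (fun h : d.-tuple int => (r h * (1 + cos (c h + 2 * pi * phase h x)))%:E) 0%E
    (pickle_inv n)))%E; last first.
  by apply/funext => x; rewrite /cos_esum esum_countable.
apply: ge0_emeasurable_sum.
  by move=> n x _ _; case: pickle_inv => //=.
move=> n _; case: pickle_inv => [h|]//=.
apply/measurable_EFinP; apply: measurable_funM => //; apply: measurable_funD => //.
exact: measurable_cos_phase.
Qed.

Lemma ge0_integral_cube (f : d.-tuple R -> \bar R) : measurable_fun setT f ->
  (forall x, (0 <= f x)%E) -> (\int[mu]_(x in cube R d) f x = \int[mu]_x f x)%E.
Proof.
move=> mf f0; rewrite -[in RHS](setUv (cube R d)) ge0_integral_setU//; last 4 first.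
- exact: (@measurable_cube R d).
- apply: measurableC; exact: (@measurable_cube R d).
- by rewrite setUv.
- by rewrite disj_set2E setICr.
rewrite [X in (_ + X)%E](_ : _ = 0%E) ?adde0//.
apply: null_set_integral.
- apply: measurableC; exact: (@measurable_cube R d).
- exact: measurable_funTS.
- have := probability_setC mu (@measurable_cube R d).
  by rewrite cube_measure_cube subee.
Qed.

Let h0 : d.-tuple int := [tuple 0 | _ < d].

Lemma korobov_r0 : r h0 = 1.
Proof. by apply: big1 => j _; rewrite tnth_mktuple /korobov_r1 eqxx. Qed.

(** The shifts by 1 integrate to [kappa], and among the cosines only the frequency 0 survives. The
    sign condition keeps both families nonnegative; the phases of the real and imaginary parts give
    the values 1 and 0. *)
Lemma integral_cos_esum c : 0 <= cos (c h0) ->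
  (\int[mu]_(x in cube R d) cos_esum c x = (kappa + cos (c h0))%:E)%E.
Proof.
move=> c0; rewrite ge0_integral_cube; last 2 first.
- exact: measurable_cos_esum.
- exact: cos_esum_ge0.
have mterm h : measurable_fun setT
    (fun x => (r h * (1 + cos (c h + 2 * pi * phase h x)))%:E).
  apply/measurable_EFinP; apply: measurable_funM => //; apply: measurable_funD => //.
  exact: measurable_cos_phase.
transitivity (\esum_(h in [set: d.-tuple int])
   (\int[mu]_x (r h * (1 + cos (c h + 2 * pi * phase h x)))%:E)%E).
  rewrite esum_countable; last by move=> h; apply: integral_ge0.
  under eq_integral do rewrite /cos_esum esum_countable//.
  rewrite integral_nneseries//; last 2 first.
  - by move=> n; case: pickle_inv => [h|]//=.
  - by move=> n x _; case: pickle_inv => /=.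
  apply: eq_eseriesr => n _; case: pickle_inv => [h|]//=.
  by rewrite integral0.
under eq_esum => h _.
  under eq_integral do rewrite EFinM.
  rewrite ge0_integralZl ?lee_fin//; last first.
    apply/measurable_EFinP; apply: measurable_funD => //; exact: measurable_cos_phase.
  rewrite integral_cos_phase -EFinM mulrDr mulr1 EFinD.
  over.
rewrite /= esumD; last 2 first.
- by move=> h _.
- move=> h _; rewrite lee_fin; case: ifP; rewrite ?mulr0// => /forallP hE.
  rewrite (_ : h = h0) ?mulr_ge0//; apply: eq_from_tnth => j.
  by rewrite tnth_mktuple; apply/eqP; exact: hE.
rewrite kappaE EFinD; congr (_ + _)%E.
rewrite -[RHS](@esum_delta _ _ h0 (fun=> cos (c h0)))//; apply: eq_esum => h _.
have -> : [forall j, tnth h j == 0] = (h == h0).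
  apply/forallP/eqP => [hE|-> j]; last by rewrite tnth_mktuple.
  by apply: eq_from_tnth => j; rewrite tnth_mktuple; apply/eqP; exact: hE.
by case: eqP => [->|_]; rewrite ?mulr0// korobov_r0 mul1r.
Qed.

Lemma valL_cube (f : cube R d -> R[i]) (x : cube R d) : valL_ 0 f (set_val x) = f x.
Proof. exact: (congr1 (fun F => F f x) (@sigL_valL _ _ (0 : R[i]) (cube R d))). Qed.

Lemma cubeP (x : d.-tuple R) : x \in cube R d -> {x' : cube R d | set_val x' = x}.
Proof. by move=> xc; exists (SigSub xc). Qed.

Lemma eq_cube_integral (f g : cube R d -> R[i]) : f =1 g -> cube_integral f = cube_integral g.
Proof. by move=> /funext ->. Qed.

Lemma Rintegral_kernel c (f : d.-tuple R -> R) : 0 <= cos (c h0) ->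
  (forall x : cube R d, f (set_val x) = fine (cos_esum c (set_val x)) - kappa) ->
  Rintegral mu (cube R d) f = cos (c h0).
Proof.
move=> c0 fE; have mc := @measurable_cube R d.
have muc : (mu (cube R d) < +oo)%E by rewrite cube_measure_cube ltry.
rewrite (@eq_Rintegral _ _ _ _ _ (fun x => fine (cos_esum c x) - kappa)); last first.
  by move=> x /cubeP[x' <-].
rewrite RintegralB//; last 2 first.
- apply: measurable_bounded_integrable => //.
    apply: measurable_funTS; apply: measurableT_comp; last exact: measurable_cos_esum.
    exact: fine_measurable.
  exists (2 * kappa); split; first by rewrite num_real.
  move=> M kM x _ /=; apply: le_trans (ltW kM).
  rewrite ger0_norm ?fine_ge0 ?cos_esum_ge0// -lee_fin fineK ?cos_esum_fin//.
  exact: cos_esum_le.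
- by apply: measurable_bounded_integrable => //; exact: bounded_cst.
have m1 : fine (mu (cube R d)) = 1 by rewrite cube_measure_cube.
rewrite Rintegral_cst// [X in _ * X]m1 mulr1 /Rintegral.
under eq_integral do rewrite fineK ?cos_esum_fin//.
by rewrite integral_cos_esum//= addrAC subrr add0r.
Qed.

Lemma cube_integral_kernel (y : cube R d) :
  cube_integral (fun x => korobov_kernel al ga x y) = 1.
Proof.
have ph0 : phase h0 (set_val y) = 0.
  by apply: big1 => j _; rewrite tnth_mktuple mul0r.
have re0 : phase_re (set_val y) h0 = 0 by rewrite /phase_re ph0 mulr0 oppr0.
rewrite /cube_integral; congr (_ +i* _)%C.
  rewrite (@Rintegral_kernel (phase_re (set_val y))) ?re0 ?cos0// => x.
  by rewrite valL_cube Re_kernel.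
rewrite (@Rintegral_kernel (phase_im (set_val y))) /phase_im ?re0 ?cosBpihalf ?sin0// => x.
by rewrite valL_cube Im_kernel.
Qed.

End kernel.
(** * Measurability in the Korobov space *)

(** Rounding down to a grid of step [1 / (n + 1)] stays in the unit interval and takes countably
    many values. *)
Definition grid_floor (R : realType) (n : nat) (t : R) : R :=
  (Num.floor (n.+1%:R * t))%:~R / n.+1%:R.

Lemma grid_floor_itv (R : realType) n (t : R) : 0 <= t <= 1 -> 0 <= grid_floor n t <= 1.
Proof.
move=> /andP[t0 t1]; have n0 : 0 < n.+1%:R :> R by [].
rewrite divr_ge0 ?ler0z ?floor_ge0 ?mulr_ge0//= ler_pdivrMr// mul1r.
by rewrite (le_trans (floor_le _))// ler_piMr.
Qed.

Lemma grid_floor_dist (R : realType) n (t : R) : `|t - grid_floor n t| <= n.+1%:R^-1.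
Proof.
have n0 : 0 < n.+1%:R :> R by [].
rewrite /grid_floor -{1}[t](mulKf (lt0r_neq0 n0)) [_^-1 * _]mulrC -mulrBl normrM.
rewrite [X in _ * X]ger0_norm ?invr_ge0// ler_piMl ?invr_ge0//.
have := floorD1_gt (n.+1%:R * t); have := floor_le (n.+1%:R * t).
by rewrite intrD => ? ?; rewrite ger0_norm ?subr_ge0//; lra.
Qed.

Lemma cvg_grid_floor (R : realType) (t : R) : grid_floor n t @[n --> \oo] --> t.
Proof.
apply/cvgrPdist_le => e e0; near=> n.
apply: le_trans (grid_floor_dist n t) _; apply/ltW.
by near: n; exact: near_infty_natSinv_lt (PosNum e0).
Unshelve. all: by end_near. Qed.

(** Each preimage is a countable union of fibres of [q], so [G] may be arbitrary. *)
Lemma measurable_fun_countable (d1 d2 : measure_display)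
    (T1 : measurableType d1) (T2 : measurableType d2) (C : countType)
    (q : T1 -> C) (G : C -> T2) :
  (forall c, measurable (q @^-1` [set c])) -> measurable_fun setT (G \o q).
Proof.
move=> mq _ Y mY; rewrite setTI.
rewrite (_ : _ @^-1` Y = \bigcup_(c in [set c | Y (G c)]) (q @^-1` [set c])).
  rewrite bigcup_mkcond; apply: countable_bigcupT_measurable => // c.
  by case: ifP.
apply/seteqP; split => x /=; first by move=> Yx; exists (q x).
by move=> [c /= Yc ->].
Qed.

Lemma cvg_sumr (R : realType) (I : Type) (s : seq I) (f : nat -> I -> R) (l : I -> R) :
  (forall i, f n i @[n --> \oo] --> l i) ->
  \sum_(i <- s) f n i @[n --> \oo] --> \sum_(i <- s) l i.
Proof.
move=> fl; elim: s => [|i s IH].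
  under eq_fun do rewrite big_nil.
  by rewrite big_nil; exact: cvg_cst.
under eq_fun do rewrite big_cons.
by rewrite big_cons; apply: cvgD.
Qed.

Section continuity.
Variables (R : realType) (al : R) (ga : nat -> R).
Hypotheses (a1 : 1 < al) (g0 : forall j, 0 <= ga j).
Variable d : nat.
Local Notation kappa := (kappa al ga d).
Local Notation r h := (korobov_r al ga h).

Lemma cos_esum_diag (x : d.-tuple R) : cos_esum al ga (phase_re x) x = (2 * kappa)%:E.
Proof.
rewrite EFinM -kappaE// -esumZl//; last by move=> h; rewrite lee_fin korobov_r_ge0.
by apply: eq_esum => h _; rewrite /phase_re addNr cos0 -EFinM mulrC.
Qed.

(** A finite set of frequencies carries [kappa] up to [e / 4], and its finite sum of cosines is
    continuous. A lower bound is what is wanted, since [2 * kappa] bounds [cos_esum] from above. *)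
Lemma cos_esum_cvg (x : d.-tuple R) (y : nat -> d.-tuple R) (e : R) : 0 < e ->
  (forall j, tnth (y n) j @[n --> \oo] --> tnth x j) ->
  \forall n \near \oo, 2 * kappa - e < fine (cos_esum al ga (phase_re (y n)) x).
Proof.
move=> e0 yx; have rg h : 0 <= r h by exact: korobov_r_ge0.
have [A [finA _] Ak] : exists2 A : set (d.-tuple int), fsets setT A &
    ((kappa - e / 4)%:E < \sum_(h \in A) (r h)%:E)%E.
  have : ((kappa - e / 4)%:E < \esum_(h in [set: d.-tuple int]) (r h)%:E)%E.
    by rewrite kappaE// lte_fin; lra.
  by move=> /ereal_sup_gt[_ [A fA <-] ltA]; exists A.
rewrite fsbig_finite//= sumEFin lte_fin in Ak; set s := finmap.enum_fset _ in Ak.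
pose T n := \sum_(h <- s) r h * (1 + cos (phase_re (y n) h + 2 * pi * phase h x)).
have Tle n : T n <= fine (cos_esum al ga (phase_re (y n)) x).
  rewrite -lee_fin fineK ?cos_esum_fin// /T -sumEFin.
  apply: ereal_sup_ubound; exists A; first by split.
  by rewrite fsbig_finite.
have Tlim : T n @[n --> \oo] --> \sum_(h <- s) r h * 2.
  apply: cvg_sumr => h.
  have -> : r h * 2 = r h * (1 + cos (phase_re x h + 2 * pi * phase h x)).
    by rewrite /phase_re addNr cos0.
  apply: cvgMl_tmp.
  apply: cvgD; first exact: cvg_cst.
  apply: continuous_cvg; first exact: continuous_cos.
  apply: cvgD; last exact: cvg_cst.
  apply: cvgN; apply: cvgMl_tmp; apply: cvg_sumr => j; apply: cvgMl_tmp; exact: yx.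
have lt : 2 * kappa - e < \sum_(h <- s) r h * 2 by rewrite -mulr_suml; lra.
near=> n; apply: lt_le_trans (Tle n); near: n; exact: cvgr_gt Tlim _ lt.
Unshelve. all: by end_near. Qed.

End continuity.

Section korobov_rkhs.
Variables (R : realType) (al : R) (ga : nat -> R).
Hypotheses (a1 : 1 < al) (g0 : forall j, 0 <= ga j).
Variables (d : nat) (H : rkhs (@korobov_kernel R al ga d)).
Local Notation Re := complex.Re.
Local Notation Im := complex.Im.
Local Notation mu := (cube_measure R d).
Local Notation kappa := (kappa al ga d).
Local Notation F := (@rkhs_fun _ _ _ H).
Local Notation ker := (@rkhs_ker _ _ _ H).
Local Notation dot := (rkhs_dot H).
Local Notation sqn := (sqnorm dot).

Lemma Re_dot_ker x y : Re (dot (ker y) (ker x))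
  = fine (cos_esum al ga (phase_re (set_val y)) (set_val x)) - kappa.
Proof. by rewrite -rkhs_repr rkhs_kerE Re_kernel. Qed.

Lemma sqnorm_ker x : sqn (ker x) = kappa.
Proof. by rewrite /sqnorm Re_dot_ker cos_esum_diag//=; ring. Qed.

Lemma kappa_ge0 : 0 <= kappa.
Proof.
rewrite -lee_fin -kappaE//; apply: esum_ge0 => h _.
by rewrite lee_fin korobov_r_ge0.
Qed.

Lemma normc_rkhs_le f x : Normc.normc (F f x) ^+ 2 <= kappa * sqn f.
Proof. by rewrite rkhs_repr mulrC -(sqnorm_ker x) cauchy_schwarz. Qed.

(** The difference of two values of [f] is its inner product with [ker x - ker y]. With
    [cos_esum_cvg] this makes every vector continuous along the grid points. *)
Lemma rkhs_funB f x y : Normc.normc (F f x - F f y) ^+ 2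
  <= sqn f * (2 * (2 * kappa - fine (cos_esum al ga (phase_re (set_val y)) (set_val x)))).
Proof.
have -> : 2 * (2 * kappa - fine (cos_esum al ga (phase_re (set_val y)) (set_val x)))
    = sqn (ker x - ker y).
  rewrite sqnormD sqnormN !sqnorm_ker linearNr raddfN/= Re_dotC Re_dot_ker; ring.
by rewrite !rkhs_repr -linearBr cauchy_schwarz.
Qed.

Lemma grid_subproof n (x : cube R d) :
  [tuple grid_floor n (tnth (set_val x) j) | j < d] \in cube R d.
Proof.
apply/mem_set => j; rewrite tnth_mktuple; apply: grid_floor_itv.
by have /set_mem := valP x; apply.
Qed.

Definition grid n (x : cube R d) : cube R d := SigSub (grid_subproof n x).

Lemma cvg_rkhs_fun f x (e : R) : 0 < e ->
  \forall n \near \oo, Normc.normc (F f x - F f (grid n x)) < e.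
Proof.
move=> e0; have f0 := sqnorm_ge0 dot f.
pose e' := e ^+ 2 / (2 * (sqn f + 1)).
have e'0 : 0 < e' by rewrite divr_gt0 ?exprn_gt0// mulr_gt0//; lra.
have lim j : tnth (set_val (grid n x)) j @[n --> \oo] --> tnth (set_val x) j.
  under eq_fun do rewrite /= tnth_mktuple.
  exact: cvg_grid_floor.
apply: filterS (cos_esum_cvg a1 g0 e'0 lim) => n SS.
rewrite -(@ltr_pXn2r _ 2)// ?nnegrE ?normc_ge0 ?(ltW e0)//.
apply: le_lt_trans (rkhs_funB _ _ _) _.
set S := fine _ in SS *.
apply: (@le_lt_trans _ _ (sqn f * (2 * e'))); first by rewrite ler_wpM2l//; lra.
have -> : sqn f * (2 * e') = e ^+ 2 * (sqn f / (sqn f + 1)).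
  by rewrite /e'; field; lra.
by rewrite gtr_pMr ?exprn_gt0// ltr_pdivrMr ?mul1r; lra.
Qed.

Lemma Re_normc_le (z : R[i]) : `|Re z| <= Normc.normc z.
Proof.
rewrite -(@ler_pXn2r _ 2)// ?nnegrE ?normc_ge0// real_normK ?num_real// normc_sqr.
by rewrite lerDl sqr_ge0.
Qed.

Lemma Im_normc_le (z : R[i]) : `|Im z| <= Normc.normc z.
Proof.
rewrite -(@ler_pXn2r _ 2)// ?nnegrE ?normc_ge0// real_normK ?num_real// normc_sqr.
by rewrite lerDr sqr_ge0.
Qed.

(** On the cube, [f] is the pointwise limit of functions that depend only on the integer tuple of
    floors [q n x]. *)
Lemma measurable_cube_grid (f : d.-tuple R -> R) :
  (forall x : cube R d, f (set_val (grid n x)) @[n --> \oo] --> f (set_val x)) ->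
  measurable_fun (cube R d) f.
Proof.
move=> fgrid.
pose q n (x : d.-tuple R) : d.-tuple int := [tuple Num.floor (n.+1%:R * tnth x j) | j < d].
pose G n (c : d.-tuple int) := f [tuple (tnth c j)%:~R / n.+1%:R | j < d].
apply: (@measurable_fun_cvg _ _ _ _ (fun n => G n \o q n)).
  move=> n; apply: measurable_funTS; apply: measurable_fun_countable => c.
  have := @measurable_box R d (fun j => [set t | Num.floor (n.+1%:R * t) = tnth c j]).
  rewrite (_ : mkset _ = q n @^-1` [set c]).
    apply=> j.
    rewrite (_ : mkset _ =
      `[(tnth c j)%:~R / n.+1%:R, (tnth c j + 1)%:~R / n.+1%:R[%classic)//.
    apply/seteqP; split => t /=; rewrite in_itv/= ler_pdivrMr// ltr_pdivlMr// mulrC.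
      by move=> <-; rewrite floor_le floorD1_gt.
    by move=> /floor_def.
  apply/seteqP; split => x /=.
    by move=> xc; apply: eq_from_tnth => j; rewrite tnth_mktuple xc.
  by move=> <- j; rewrite tnth_mktuple.
move=> x /mem_set/cubeP[x' <-].
suff -> : (fun n => (G n \o q n) (set_val x')) = (fun n => f (set_val (grid n x'))).
  exact: fgrid.
apply/funext => n; rewrite /G /q/=; congr f; apply: eq_from_tnth => j.
by rewrite !tnth_mktuple.
Qed.

Lemma measurable_Re_rkhs f : measurable_fun (cube R d) (fun x => Re (valL_ 0 (F f) x)).
Proof.
apply: measurable_cube_grid => x; under eq_fun do rewrite valL_cube.
rewrite valL_cube; apply/cvgrPdist_lt => e e0; have := cvg_rkhs_fun f x e0.
by apply: filterS => n; apply: le_lt_trans; rewrite -raddfB Re_normc_le.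
Qed.

Lemma measurable_Im_rkhs f : measurable_fun (cube R d) (fun x => Im (valL_ 0 (F f) x)).
Proof.
apply: measurable_cube_grid => x; under eq_fun do rewrite valL_cube.
rewrite valL_cube; apply/cvgrPdist_lt => e e0; have := cvg_rkhs_fun f x e0.
by apply: filterS => n; apply: le_lt_trans; rewrite -raddfB Im_normc_le.
Qed.

End korobov_rkhs.
(** * The worst-case error formula *)

Section trigonometric_sum.
Variables (R : realType) (N : nat) (a : int).
Hypothesis N0 : (0 < N)%N.

Let th (k : nat) : R := 2 * pi * (k%:R * a%:~R / N%:R).
Let C : R := \sum_(k < N) cos (th k).
Let S : R := \sum_(k < N) sin (th k).

Let NR0 : N%:R != 0 :> R. Proof. by rewrite pnatr_eq0 -lt0n. Qed.

Let thS k : th k.+1 = th k + th 1.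
Proof. by rewrite /th -addn1 natrD; ring. Qed.

Let th_period k : th (k + N)%N = th k + a%:~R * (2 * pi).
Proof. by rewrite /th natrD; field. Qed.

Let th0 : th 0 = 0. Proof. by rewrite /th !mul0r mulr0. Qed.

(** A shift by one angle drops the first term and appends the one at index [N], which equals the
    first by periodicity. *)
Lemma sum_shift (f : R -> R) : (forall x, f (x + a%:~R * (2 * pi)) = f x) ->
  \sum_(k < N) f (th k + th 1) = \sum_(k < N) f (th k).
Proof.
move=> fper; under eq_bigr do rewrite -thS.
have fN : f (th N) = f (th 0) by rewrite -[N]add0n th_period fper.
case: N N0 fN => [//|n] _ fN.
by rewrite big_ord_recr/= fN [RHS]big_ord_recl/= addrC.
Qed.

(** A nonzero remainder [e] gives, up to full turns, the angle [2 * y] with [0 < y < pi], whose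
    cosine [1 - 2 * sin y ^ 2] is less than 1. *)
Lemma cos_eq1_dvdz : cos (th 1) = 1 -> (N%:Z %| a)%Z.
Proof.
move=> c1; have NZ0 : N%:Z != 0 by rewrite eqz_nat -lt0n.
have := divz_eq a N; set q := (a %/ N)%Z; set e := (a %% N)%Z => aE.
have e0 : 0 <= e by exact: modz_ge0.
have eN : e < N%:Z by exact: ltz_pmod.
have [e00|eN0] := eqVneq e 0; first exact/dvdz_mod0P.
exfalso; pose y : R := pi * (e%:~R / N%:R).
have yE : th 1 = (y + y) + q%:~R * (2 * pi).
  by rewrite /th /y aE intrD intrM mul1r; field.
have y0 : 0 < y < pi.
  have ep : 0 < e by rewrite lt_neqAle eq_sym eN0.
  rewrite /y mulr_gt0 ?pi_gt0 ?divr_gt0 ?ltr0z ?ltr0n//= gtr_pMr ?pi_gt0//.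
  by rewrite ltr_pdivrMr ?ltr0n// mul1r -[N%:R]/(N%:~R) ltr_int.
move: c1; rewrite yE cosD2piz cosD -!expr2 cos2sin2.
have := sin_gt0_pi y0; move=> sy.
have : 0 < sin y ^+ 2 by rewrite exprn_gt0.
lra.
Qed.

(** The double sum is the squared modulus [C ^ 2 + S ^ 2] of the exponential sum. If [N] does not
    divide [a], invariance of the sum under rotation by [th 1], which is not a full turn, forces it
    to vanish. *)
Lemma sum_cos_sub : \sum_(k < N) \sum_(l < N) cos (th k - th l)
  = (if (N%:Z %| a)%Z then N%:R ^+ 2 else 0).
Proof.
transitivity (C ^+ 2 + S ^+ 2).
  rewrite !expr2 /C /S !mulr_suml -big_split/=; apply: eq_bigr => k _.
  rewrite !mulr_sumr -big_split/=; apply: eq_bigr => l _.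
  by rewrite cosB.
case: ifPn => [/dvdzP[q aE]|Na].
  have thE k : th k = 0 + (k%:Z * q)%:~R * (2 * pi).
    by rewrite /th aE !intrM add0r; field.
  rewrite /C /S; under eq_bigr do rewrite thE cosD2piz cos0.
  under [in X in _ + X]eq_bigr do rewrite thE sinD2piz sin0.
  by rewrite sumr_const card_ord big1_eq expr0n addr0.
have C1 : C = C * cos (th 1) - S * sin (th 1).
  rewrite {1}/C -(@sum_shift cos) => [|x]; last exact: cosD2piz.
  under eq_bigr do rewrite cosD.
  by rewrite sumrB -!mulr_suml.
have S1 : S = S * cos (th 1) + C * sin (th 1).
  rewrite {1}/S -(@sum_shift sin) => [|x]; last exact: sinD2piz.
  under eq_bigr do rewrite sinD.
  by rewrite big_split/= -!mulr_suml.
have c1 : 1 - cos (th 1) != 0.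
  by rewrite subr_eq0 eq_sym; apply: contraNneq Na => /cos_eq1_dvdz.
have eC : (1 - cos (th 1)) * C = - (S * sin (th 1)) by lra.
have eS : (1 - cos (th 1)) * S = C * sin (th 1) by lra.
by apply: (mulfI c1); rewrite mulr0 mulrDr !expr2 !mulrA eC eS; ring.
Qed.

End trigonometric_sum.

(** * The squared error as a dual lattice sum *)

Section worst_case_error.
Variables (R : realType) (al : R) (ga : nat -> R).
Hypotheses (a1 : 1 < al) (g0 : forall j, 0 <= ga j).
Variables (d : nat) (H : rkhs (@korobov_kernel R al ga d)).
Local Notation Re := complex.Re.
Local Notation Im := complex.Im.
Local Notation mu := (cube_measure R d).
Local Notation kappa := (kappa al ga d).
Local Notation F := (@rkhs_fun _ _ _ H).
Local Notation ker := (@rkhs_ker _ _ _ H).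
Local Notation dot := (rkhs_dot H).
Local Notation sqn := (sqnorm dot).
Local Open Scope complex_scope.

Let fre f (x : d.-tuple R) : R := Re (valL_ 0 (F f) x).
Let fim f (x : d.-tuple R) : R := Im (valL_ 0 (F f) x).

Let mc : measurable (cube R d) := @measurable_cube R d.

Let muc : (mu (cube R d) < +oo)%E. Proof. by rewrite cube_measure_cube ltry. Qed.

Let bound f : R := Num.sqrt (kappa * sqn f).

Let bound_sqr f : bound f ^+ 2 = kappa * sqn f.
Proof. by rewrite sqr_sqrtr// mulr_ge0 ?sqnorm_ge0// kappa_ge0. Qed.

Let normc_bound f x : Normc.normc (F f x) <= bound f.
Proof.
rewrite -(@ler_pXn2r _ 2)// ?nnegrE ?normc_ge0 ?sqrtr_ge0// bound_sqr.
exact: normc_rkhs_le.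
Qed.

Let cube_bound (g : d.-tuple R -> R) f : (forall x : cube R d, `|g (set_val x)| <= bound f) ->
  measurable_fun (cube R d) g -> mu.-integrable (cube R d) (EFin \o g).
Proof.
move=> gb mg; apply: measurable_bounded_integrable => //.
exists (bound f); split; first by rewrite num_real.
by move=> M fM x /mem_set/cubeP[x' <-]/=; apply: le_trans (gb x') (ltW fM).
Qed.

Let ifre f : mu.-integrable (cube R d) (EFin \o fre f).
Proof.
apply: (@cube_bound _ f); last exact: measurable_Re_rkhs.
by move=> x; rewrite /fre valL_cube (le_trans (Re_normc_le _)).
Qed.

Let ifim f : mu.-integrable (cube R d) (EFin \o fim f).
Proof.
apply: (@cube_bound _ f); last exact: measurable_Im_rkhs.
by move=> x; rewrite /fim valL_cube (le_trans (Im_normc_le _)).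
Qed.

Lemma cube_integral_scalar : scalar (fun f : rkhs_car H => cube_integral (F f)).
Proof.
move=> a u v; have Fl := @rkhs_fun_scalar _ _ _ H.
have iZ b (g : d.-tuple R -> R) : mu.-integrable (cube R d) (EFin \o g) ->
    mu.-integrable (cube R d) (EFin \o (fun x => b * g x)).
  by move=> ig; apply: (integrableZl mc b ig).
have lin b c f g k :
    mu.-integrable (cube R d) (EFin \o f) -> mu.-integrable (cube R d) (EFin \o g) ->
    mu.-integrable (cube R d) (EFin \o k) ->
    Rintegral mu (cube R d) (fun x => b * f x + c * g x + k x)
    = b * Rintegral mu (cube R d) f + c * Rintegral mu (cube R d) g
      + Rintegral mu (cube R d) k.
  move=> fi gi ki; have fi' := iZ b _ fi; have gi' := iZ c _ gi.
  rewrite RintegralD//; last exact: (integrableD mc fi' gi').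
  by rewrite RintegralD// !RintegralZl.
rewrite /cube_integral -/(fre _) -/(fim _) -/(fre u) -/(fim u) -/(fre v) -/(fim v).
rewrite (@eq_Rintegral _ _ _ _ _
  (fun x => Re a * fre u x + - Im a * fim u x + fre v x)); last first.
  move=> x /cubeP[x' <-]; rewrite /fre /fim !valL_cube Fl.
  by case: a (F u x') (F v x') => [? ?] [? ?] [? ?] /=; rewrite mulNr.
rewrite [X in _ +i* X](@eq_Rintegral _ _ _ _ _
  (fun x => Im a * fre u x + Re a * fim u x + fim v x)); last first.
  move=> x /cubeP[x' <-]; rewrite /fre /fim !valL_cube Fl.
  by case: a (F u x') (F v x') => [? ?] [? ?] [? ?] /=; rewrite [X in X + _]addrC.
rewrite !lin//; case: a => [x y] /=.
by rewrite [y * _ + _]addrC mulNr.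
Qed.

Lemma cube_integral_le f : Re (cube_integral (F f)) ^+ 2 <= kappa * sqn f.
Proof.
rewrite -bound_sqr -ler_sqrt ?sqr_ge0// !sqrtr_sqr [X in _ <= X]ger0_norm ?sqrtr_ge0//.
rewrite /cube_integral /= -/(fre f).
apply: le_trans (le_normr_Rintegral mc (ifre f)) _.
apply: (@le_trans _ _ (Rintegral mu (cube R d) (cst (bound f)))).
  apply: le_Rintegral => //.
  - exact: integrable_norm.
  - by apply: measurable_bounded_integrable => //; exact: bounded_cst.
  - by move=> x /mem_set/cubeP[x' <-]; rewrite /fre valL_cube (le_trans (Re_normc_le _)).
have m1 : fine (mu (cube R d)) = 1 by rewrite cube_measure_cube.
by rewrite Rintegral_cst// [X in _ * X]m1 mulr1.
Qed.

Lemma integral_representer : exists v : rkhs_car H,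
  (forall f, cube_integral (F f) = dot f v) /\ (forall x, F v x = 1) /\ sqn v = 1.
Proof.
have [v vP] := @riesz _ _ dot (@rkhs_complete _ _ _ H) _ _
  cube_integral_scalar (@kappa_ge0 _ _ _ a1 g0 d) cube_integral_le.
have v1 x : F v x = 1.
  rewrite rkhs_repr dot_conj -vP.
  rewrite (eq_cube_integral (fun y => rkhs_kerE H y x)) cube_integral_kernel//.
  exact: rmorph1.
exists v; split; [exact: vP|split=> //].
have m1 : fine (mu (cube R d)) = 1 by rewrite cube_measure_cube.
rewrite /sqnorm -vP -[LHS]/(Rintegral mu (cube R d) (fre v)).
rewrite (@eq_Rintegral _ _ _ _ _ (cst 1)); last first.
  by move=> x /cubeP[x' <-]; rewrite /fre valL_cube v1.
by rewrite Rintegral_cst// [X in _ * X]m1 mulr1.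
Qed.

Lemma wce_dist N (z : d.-tuple nat) : (0 < N)%N -> exists r : rkhs_car H,
  wce H N z = (Num.sqrt (sqn r))%:E /\
  sqn r = N%:R^-1 ^+ 2 * \sum_(k < N) \sum_(l < N)
     Re (korobov_kernel al ga (lattice_point R N z k) (lattice_point R N z l)) - 1.
Proof.
move=> N0; have [v [vP [v1 vn]]] := integral_representer.
set x := lattice_point R N z.
have NC0 : N%:R != 0 :> R[i] by rewrite pnatr_eq0 -lt0n.
pose g := (N%:R^-1 : R[i]) *: \sum_(k < N) ker (x k).
have dotg f : dot f g = N%:R^-1 * \sum_(k < N) F f (x k).
  rewrite /g linearZr_LR/= rmorphV ?unitfE// rmorph_nat; congr (_ * _).
  by rewrite linear_sumr/=; apply: eq_bigr => k _; rewrite rkhs_repr.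
exists (v - g); split.
  have LE f : cube_integral (F f) - N%:R^-1 * \sum_(k < N) F f (x k) = dot f (v - g).
    by rewrite linearBr/= vP dotg.
  rewrite /wce; set s := Num.sqrt _; have s0 : 0 <= s by exact: sqrtr_ge0.
  have s2 : s ^+ 2 = sqn (v - g) by rewrite sqr_sqrtr// sqnorm_ge0.
  apply/eqP; rewrite eq_le; apply/andP; split.
    apply: ge_ereal_sup => _ [f /= f1 <-]; rewrite lee_fin LE.
    rewrite -(@ler_pXn2r _ 2)// ?nnegrE ?normc_ge0//.
    apply: le_trans (cauchy_schwarz _ _ _) _; rewrite s2.
    rewrite ler_piMl ?sqnorm_ge0//.
    by move: f1; rewrite dot_sqnorm lecE => /andP[_].
  apply: ereal_sup_ubound => /=.
  (* The supremum is attained at the normalized [v - g], or at the zero vector if [v - g] has norm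
     0. *)
  have [sE|sN0] := eqVneq s 0.
    exists 0; first by rewrite linear0r ler01.
    by rewrite LE linear0l sE; congr EFin; exact: Normc.normc0.
  exists ((s^-1)%:C *: (v - g)).
    by rewrite dot_sqnorm sqnormZ -s2 -exprMn mulVf// expr1n.
  rewrite LE.
  have -> : dot ((s^-1)%:C *: (v - g)) (v - g) = s%:C.
    by rewrite linearZl_LR/= dot_sqnorm -s2 expr2 rmorphM fmorphV mulKf// fmorph_eq0.
  by congr EFin; rewrite /Normc.normc/= expr0n addr0 sqrtr_sqr ger0_norm.
(* [dot v g] is the mean of the values of [v], that is 1, so [|v - g|^2 = 1 + |g|^2 - 2]. *)
rewrite sqnormD sqnormN linearNr raddfN/= vn dotg.
have -> : \sum_(k < N) F v (x k) = N%:R.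
  by under eq_bigr do rewrite v1; rewrite sumr_const card_ord.
rewrite mulVf//=.
suff -> : sqn g = N%:R^-1 ^+ 2
    * \sum_(k < N) \sum_(l < N) Re (korobov_kernel al ga (x k) (x l)).
  by ring.
have NE : (N%:R^-1 : R[i]) = (N%:R^-1)%:C by rewrite fmorphV rmorph_nat.
rewrite {1}/g NE sqnormZ; congr (_ * _).
rewrite /sqnorm linear_sumr/= raddf_sum/=; apply: eq_bigr => k _.
rewrite linear_sumlz/= raddf_sum/=; apply: eq_bigr => l _.
by rewrite -rkhs_repr rkhs_kerE.
Qed.

Lemma sum_cos_esum_lattice N (z : d.-tuple nat) : (0 < N)%N ->
  (\sum_(k < N) \sum_(l < N) cos_esum al ga (phase_re (set_val (lattice_point R N z l)))
      (set_val (lattice_point R N z k))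
   = (N%:R ^+ 2)%:E * (kappa%:E + dual_sum al ga N z))%E.
Proof.
move=> N0; have rg h : 0 <= korobov_r al ga h :> R by exact: korobov_r_ge0.
rewrite -kappaE// /dual_sum -esumD; last 2 first.
- by move=> h _; rewrite lee_fin.
- by move=> h _; rewrite lee_fin; case: ifP.
rewrite -esumZl; last 2 first.
- exact: sqr_ge0.
- by move=> h; rewrite -EFinD lee_fin addr_ge0//; case: ifP.
under eq_bigr => k _.
  rewrite /cos_esum -esum_sum; last first.
    by move=> h l _ _; rewrite lee_fin mulr_ge0// cosD1_ge0.
  over.
rewrite /= -esum_sum; last first.
  move=> h k _ _; apply: sume_ge0 => l _; rewrite lee_fin mulr_ge0// cosD1_ge0//.
apply: eq_esum => h _; under eq_bigr do rewrite sumEFin.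
rewrite sumEFin -EFinD -EFinM; congr EFin.
under eq_bigr do rewrite -mulr_sumr big_split/= sumr_const card_ord.
set a := lattice_dot z h; pose T (k : nat) : R := 2 * pi * (k%:R * a%:~R / N%:R).
(* Taking fractional parts changes the phase by this integer multiple of [2 * pi], invisible to the
   cosine. *)
pose M (k : nat) : int := - \sum_(j < d) tnth h j * Num.floor ((k * tnth z j)%:R / N%:R : R).
have phE k : 2 * pi * phase h (set_val (lattice_point R N z k)) = T k + (M k)%:~R * (2 * pi).
  rewrite [_ * (2 * pi)]mulrC -mulrDr; congr (_ * _).
  rewrite /phase /a /lattice_dot /M rmorphN !rmorph_sum/= mulr_sumr mulr_suml -sumrB.
  apply: eq_bigr => j _; rewrite tnth_mktuple /Defs.frac !intrM natrM.
  rewrite -[(tnth z j)%:~R]/((tnth z j)%:R).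
  by ring.
have cosE k l : cos (phase_re (set_val (lattice_point R N z l)) h
    + 2 * pi * phase h (set_val (lattice_point R N z k))) = cos (T k - T l).
  rewrite /phase_re !phE -[RHS](cosD2piz _ (M k - M l)) intrD intrN; congr cos; ring.
rewrite -mulr_sumr; under eq_bigr do under eq_bigr do rewrite cosE.
rewrite big_split/= sumr_const card_ord sum_cos_sub// -[N%:R *+ N]mulr_natl.
by case: ifP => _; ring.
Qed.

Lemma wce_sqr N (z : d.-tuple nat) : (0 < N)%N ->
  (wce H N z ^+ 2 = dual_sum al ga N z - 1)%E.
Proof.
move=> N0; have [r [-> rE]] := wce_dist z N0.
rewrite -EFin_expe sqr_sqrtr ?sqnorm_ge0// rE.
have N0R : N%:R != 0 :> R by rewrite pnatr_eq0 -lt0n.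
have Sfin : dual_sum al ga N z \is a fin_num.
  rewrite fin_numElt dual_sum_lty// andbT (lt_le_trans (ltNyr 0))//.
  by apply: esum_ge0 => h _; rewrite lee_fin; case: ifP => // _; exact: korobov_r_ge0.
pose c (k l : nat) := fine (cos_esum al ga (phase_re (set_val (lattice_point R N z l)))
  (set_val (lattice_point R N z k))).
have sE : \sum_(k < N) \sum_(l < N) c k l = N%:R ^+ 2 * (kappa + fine (dual_sum al ga N z)).
  apply: EFin_inj; rewrite EFinM EFinD (fineK Sfin) -sum_cos_esum_lattice// -sumEFin.
  apply: eq_bigr => k _; rewrite -sumEFin; apply: eq_bigr => l _.
  by rewrite fineK// cos_esum_fin.
rewrite -(fineK Sfin) -EFinB; congr (_ - _)%:E.
under eq_bigr do under eq_bigr do rewrite Re_kernel// -/(c _ _).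
under eq_bigr do rewrite sumrB sumr_const card_ord.
rewrite sumrB sE sumr_const card_ord -mulrnA -[kappa *+ _]mulr_natl natrM.
by field.
Qed.

End worst_case_error.
Theorem theorem3p2 (R : realType) (s b m : nat) (w : nat -> nat)
  (alpha : R) (gamma : nat -> R)
  (H : forall d : nat, rkhs (@korobov_kernel R alpha gamma d))
  (E : nat -> {set 'I_(b ^ m)}) (z : nat -> 'I_(b ^ m)) (zt : nat -> nat) :
  (0 < s)%N -> prime b -> (0 < m)%N ->
  w 0%N = 0%N -> (forall j : nat, (w j <= w j.+1)%N) ->
  1 < alpha -> (forall j : nat, 0 < gamma j) ->
  combined_cbc (fun (d : nat) (y : d.-tuple nat) =>
                  (wce (H d) (b ^ m) y ^+ 2)%E) w s E z zt ->
  forall (d : nat) (lambda : R),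
    (0 < d <= s)%N -> alpha^-1 < lambda <= 1 ->
    (wce (H d) (b ^ m) [tuple zt i | i < d] ^+ 2 <=
     ((\sum_(u : {set 'I_d})
         (\prod_(j in u) gamma j) `^ lambda * (4 * zeta (alpha * lambda)) ^+ #|u|
         / (totient (b ^ (m - \max_(j in u) w j)))%:R
         * \prod_(j in u)
             (#|search_space b m (w j)|%:R
              / (#|search_space b m (w j)|%:R - #|E j|%:R)))
      `^ lambda^-1)%:E)%E.
Proof.
move=> s0 pb m0 w0 wS a1 g0 cbc d l /andP[_ ds] /andP[al l1].
have ga0 j : 0 <= gamma j by exact: ltW.
have l0 : 0 < l by apply: lt_trans al; rewrite invr_gt0; lra.
have l01 : 0 < l <= 1 by rewrite l0.
have al1 : 1 < alpha * l by rewrite mulrC -ltr_pdivrMr ?div1r//; lra.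
have N0 : (0 < b ^ m)%N by rewrite expn_gt0 prime_gt0.
have e2E n (y : n.-tuple nat) : (wce (H n) (b ^ m) y ^+ 2
    = dual_sum alpha gamma (b ^ m) y - 1)%E by exact: wce_sqr.
have := cbc_e2_bound pb m0 w0 wS a1 ga0 l01 al1 e2E cbc ds.
(* Provides finiteness of the worst-case error, so that the claim becomes an inequality between
   reals. *)
have [r [wE _]] := wce_dist a1 ga0 (H d) [tuple zt i | i < d] N0.
rewrite wE -EFin_expe lee_fin /= => le_bound.
set x := _ ^+ 2 in le_bound *; set B := \sum_u _.
have {}le_bound : x `^ l <= B.
  apply: le_trans le_bound _; rewrite le_eqVlt; apply/orP; left; apply/eqP.
  apply: eq_bigr => u _; rewrite big_split/= [RHS]mulrAC; congr (_ * _ / _).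
  by rewrite big_split/= prodr_const powR_prod.
have B0 : 0 <= B by apply: le_trans le_bound; exact: powR_ge0.
have x0 : 0 <= x by exact: sqr_ge0.
rewrite -[x]powRr1// -(divff (lt0r_neq0 l0)) powRrM.
by rewrite ge0_ler_powR ?nnegrE ?powR_ge0// invr_ge0 ltW.
Qed.
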